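(* Let $\varphi$ be an index function such that for every $\eta>0$ the quotient function $t\mapsto t^\eta/\varphi(t)$ is strictly increasing for sufficiently small $t>0$, and suppose that the source condition $$u^\dagger-\bar u=\varphi(G)\,w$$ holds for some $w\in X$. Then, with $K_2:=\max\{2/c_a,1\}$, there is a constant $K_0>0$ such that for all $\delta>0$ and all sufficiently small $\alpha>0$ (i.e. all $0<\alpha\le\bar\alpha$ with some $\bar\alpha>0$ independent of $\delta$), all data $f^\delta\in Y$ with $\|f^\delta-f^\dagger\|\le\delta$ and all corresponding regularized solutions $u_\alpha^\delta$, $$\|u_\alpha^\delta-u^\dagger\|\le K_0\,\varphi(\alpha)+K_2\,\frac{\delta}{\alpha^{a/(2a+2)}}.$$
   Context: Setting. $X,Y$ are infinite-dimensional Hilbert spaces, norms $\|\cdot\|$. $B: X\supset \mathcal D(B)\to X$ is a self-adjoint, positive definite, unbounded linear operator with dense domain and $\|Bu\|\ge m\|u\|$ for all $u\in\mathcal D(B)$, for some constant $m>0$. For $\tau\in\mathbb R$ put $\|u\|_\tau:=\|B^\tau u\|$ for $u\in X_\tau$, where $X_\tau:=\mathcal D(B^\tau)$ for $\tau>0$ and $X_\tau:=X$ for $\tau\le 0$ (no completion is taken for $\tau<0$). Standing assumptions. $F: X\supset\mathcal D(F)\to Y$ is a (possibly nonlinear) operator such that: (a) $F$ is sequentially continuous on $\mathcal D(F)$ with respect to the weak topologies of $X$ and $Y$; (b) $\mathcal D(F)\subset X$ is closed and convex; (c) $\mathcal D:=\mathcal D(F)\cap X_1$ is non-empty, where $X_1=\mathcal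 D(B)$; (d) $u^\dagger\in\mathcal D(F)$ satisfies $F(u^\dagger)=f^\dagger$ and is an interior point of $\mathcal D(F)$ (it is not required that $u^\dagger\in X_1$); (e) the data $f^\delta\in Y$ satisfy $\|f^\delta-f^\dagger\|\le\delta$, and the initial guess $\bar u$ lies in $\mathcal D$; (f) there are $a>0$ and constants $0<c_a\le C_a<\infty$ with $$c_a\|u-u^\dagger\|_{-a}\le\|F(u)-f^\dagger\|\le C_a\|u-u^\dagger\|_{-a}\quad\text{for all }u\in\mathcal D.$$ Tikhonov regularization. For $\alpha>0$ let $T_\alpha^\delta(u):=\|F(u)-f^\delta\|^2+\alpha\|u-\bar u\|_1^2$, to be minimized over $u\in\mathcal D(F)$ (with $\|u-\bar u\|_1=+\infty$ if $u\notin X_1$, so minimizers lie in $\mathcal D$). Minimizers exist for each $\alpha>0$ but need not be unique; $u_\alpha^\delta\in\mathcal D$ denotes an arbitrary minimizer (regularized solution). Further notation. $G:=B^{-(2a+2)}:X\to X$, a bounded, injective, self-adjoint, positive semidefinite linear operator. An index function is a continuous, non-decreasing function $\varphi:(0,\infty)\to(0,\infty)$ with $\lim_{t\to0}\varphi(t)=0$. The operator $\varphi(G)$ is defined by the spectral calculus (with $\varphi(0):=0$). *)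

(* Defs.v *)
From HB Require Import structures.
From mathcomp Require Import all_boot all_order all_algebra.
From mathcomp Require Import all_classical all_reals all_analysis.

Set Implicit Arguments.
Unset Strict Implicit.
Unset Printing Implicit Defensive.

Import Order.TTheory GRing.Theory Num.Theory.
Import numFieldTopology.Exports numFieldNormedType.Exports.

Local Open Scope classical_set_scope.
Local Open Scope ring_scope.

(* Hilbert spaces are real. A complex Hilbert space is covered by restricting
   scalars and taking the real part of its inner product: self-adjointness,
   weak convergence and the real spectral calculus below are unchanged. *)
HB.mixin Record CompleteNormedModule_isHilbert (R : realType) X
    of CompleteNormedModule R X := {
  dot : X -> X -> R ;
  dotC : forall u v, dot u v = dot v u ;
  dotP : forall (c : R) u v w, dot (c *: u + v) w = c * dot u w + dot v w ;
  dotxx : forall u, dot u u = `|u| ^+ 2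
}.

#[short(type="hilbertType")]
HB.structure Definition Hilbert (R : realType) :=
  {X of CompleteNormedModule R X & CompleteNormedModule_isHilbert R X}.

Definition infinite_dimensional (R : realType) (X : lmodType R) : Prop :=
  forall (n : nat) (b : 'I_n -> X),
    exists x : X, forall c : 'I_n -> R, x <> \sum_(i < n) c i *: b i.

Definition weak_cvg (R : realType) (X : normedModType R)
    (x_ : nat -> X) (x : X) : Prop :=
  forall l : {linear X -> R^o}, continuous l -> l (x_ n) @[n --> \oo] --> l x.

Definition weakly_seq_continuous (R : realType) (X Y : normedModType R)
    (D : set X) (F : X -> Y) : Prop :=
  forall (x_ : nat -> X) (x : X), (forall n, D (x_ n)) -> D x ->
    weak_cvg x_ x -> weak_cvg (F \o x_) (F x).

(* Not necessarily everywhere defined operators: the values of [opval] outside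
   [dom] are irrelevant. *)
Record partial_op (X : Type) := PartialOp { dom : set X ; opval :> X -> X }.

Section operators.
Variables (R : realType) (X : hilbertType R).
Implicit Types (A B : partial_op X) (T : X -> X).

Definition linear_op B : Prop :=
  dom B 0 /\
  forall (c : R) (u v : X), dom B u -> dom B v ->
    dom B (c *: u + v) /\ B (c *: u + v) = c *: B u + B v.

Definition adjoint_graph B (v z : X) : Prop :=
  forall u, dom B u -> dot (B u) v = dot u z.

(* The adjoint and B have the same graph, hence the same domain. *)
Definition self_adjoint B : Prop :=
  [/\ linear_op B, dense (dom B)
    & forall v z, adjoint_graph B v z <-> dom B v /\ B v = z].

Definition positive_definite B : Prop :=
  forall u, dom B u -> u != 0 -> 0 < dot (B u) u.

Definition unbounded_op B : Prop :=
  ~ exists C : R, forall u, dom B u -> `|B u| <= C * `|u|.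

Definition inv_op B : partial_op X :=
  PartialOp (B @` dom B) (fun v => xget 0 [set u | dom B u /\ B u = v]).

Definition opnorm T : R := sup [set `|T u| | u in [set u : X | `|u| <= 1]].

Definition poly_op (p : {poly R}) T (u : X) : X :=
  \sum_(i < size p) p`_i *: iter i T u.

(* Spectral calculus f(T) of a bounded, self-adjoint, positive semidefinite T
   and a function f continuous on [0, opnorm T], an interval containing the
   spectrum of T: f(T) u is the limit of p_n(T) u for polynomials p_n tending
   to f uniformly on that interval. *)
Definition spectral_calc T (f : R -> R) (u : X) : X :=
  xget 0 [set v | exists p_ : nat -> {poly R},
    {uniform `[0, opnorm T], (fun n x => (p_ n).[x]) @ \oo --> f} /\
    poly_op (p_ n) T u @[n --> \oo] --> v].

(* Fractional powers of a positive B with bounded inverse. For s > 0, B^{-s} is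
   the function t |-> t^s of the bounded operator B^{-1}, and B^s is the
   inverse of B^{-s}, with domain the range of B^{-s}. *)
Definition neg_power B (s : R) : X -> X :=
  spectral_calc (inv_op B) (fun t => t `^ s).

Definition power_op B (tau : R) : partial_op X :=
  if 0 < tau then inv_op (PartialOp setT (neg_power B tau))
  else if tau < 0 then PartialOp setT (neg_power B (- tau))
  else PartialOp setT idfun.

Definition scale_space B (tau : R) : set X :=
  if 0 < tau then dom (power_op B tau) else setT.

Definition scale_norm B (tau : R) (u : X) : R := `|power_op B tau u|.

End operators.

Section tikhonov.
Variables (R : realType) (X Y : hilbertType R).

Definition tikhonov (B : partial_op X) (F : X -> Y) (ubar : X) (fdelta : Y)
    (alpha : R) (u : X) : \bar R :=
  if u \in scale_space B 1 then
    (`|F u - fdelta| ^+ 2 + alpha * scale_norm B 1 (u - ubar) ^+ 2)%:E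
  else +oo%E.

Definition regularized_solution (B : partial_op X) (DF : set X) (F : X -> Y)
    (ubar : X) (fdelta : Y) (alpha : R) (u : X) : Prop :=
  DF u /\
  forall v, DF v ->
    (tikhonov B F ubar fdelta alpha u <= tikhonov B F ubar fdelta alpha v)%E.

End tikhonov.

Section index_functions.
Variable R : realType.
Implicit Type phi : R -> R.

(* Only the values of phi on (0, oo) matter. *)
Definition index_function phi : Prop :=
  [/\ forall t, 0 < t -> 0 < phi t,
      {in `]0, +oo[, continuous phi},
      {in `]0, +oo[ &, {homo phi : s t / s <= t}}
    & phi t @[t --> 0^'+] --> 0].

Definition extend0 phi (t : R) : R := if 0 < t then phi t else 0.

Definition quotient_incr_near0 phi (eta : R) : Prop :=
  exists2 t0, 0 < t0 &
    forall s t, 0 < s -> s < t -> t <= t0 -> s `^ eta / phi s < t `^ eta / phi t.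

End index_functions.

(* Main.v *)
Require Import Defs.
From HB Require Import structures.
From mathcomp Require Import all_boot all_order all_algebra.
From mathcomp Require Import all_classical all_reals all_analysis.
From mathcomp Require Import ring lra zify.

Set Implicit Arguments.
Unset Strict Implicit.
Unset Printing Implicit Defensive.

Import Order.TTheory GRing.Theory Num.Theory.
Import numFieldTopology.Exports numFieldNormedType.Exports.
Local Open Scope classical_set_scope.
Local Open Scope ring_scope.

(** The functional calculus of B^-1 turns the problem into estimates for
    functions of one variable. Write A = B^-1 and r = 2 a + 2, so that G = A^r
    and phi(G) is the function t |-> phi(t^r) of A. Put alpha = s^r.

    - Auxiliary element. Minimizing the linear model
      |u - u_dag|_{-a}^2 + alpha |u - ubar|_1^2 gives
      u_al = ubar + G (G + alpha)^-1 (u_dag - ubar). The three quantities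
      |u_al - u_dag|, s^-a |u_al - u_dag|_{-a} and s |u_al - ubar|_1 are norms
      of functions of A applied to w, and each is bounded by a multiple of
      phi(alpha): on x = t^r the functions are x^(1-eta) phi(x) / (x + alpha)
      up to powers of alpha, with eta = 1, 1 - a/r and 1/r, and the monotonicity
      of x^eta / phi(x) near 0 bounds them by C alpha^(-eta) phi(alpha)
      ([filtered_index_bound], [source_splitting]).

    - Comparison. Since u_dag is interior to DF and u_al tends to it, u_al is
      admissible for small alpha, and comparing the Tikhonov functional at a
      minimizer u and at u_al, with the two-sided estimate on F, gives
      |u - u_al|_{-a} <= s^a M and |u - u_al|_1 <= M / s, where M is
      K phi(alpha) + max(2/ca, 1) delta / s^a. The coefficient of delta is not
      enlarged because the squares are summed through P^2 + V^2 <= (P + V)^2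
      with only P containing delta.

    - Interpolation. |v| <= |v|_{-a}^(1/(a+1)) |v|_1^(a/(a+1)), used in the form
      of Young's inequality on the spectrum, yields |u - u_al| <= M
      ([interpolation_inequality]).

    The calculus itself rests on one fact: a polynomial that is nonnegative on
    [0, |T|] takes a symmetric positive T to a positive semidefinite operator
    ([poly_op_ge0]). It follows from the expansion in Bernstein polynomials,
    whose coefficients are asymptotically the values of the polynomial, since
    T^k (M - T)^(n-k) is positive semidefinite. The same polynomials prove the
    Weierstrass theorem, which supplies the approximating sequences. Norm bounds,
    the product rule and the composition rule phi(G) = (phi o t^r)(A) are then
    limits of identities between polynomials. That A is everywhere defined,
    bounded, symmetric and positive comes from the closed range of B and the
    projection theorem ([bounded_below_surj]). *)

(** * Bernstein polynomials *)

Lemma mul_bin_subset (n k j : nat) : (j <= k)%N -> (k <= n)%N ->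
  ('C(k, j) * 'C(n, k) = 'C(n, j) * 'C(n - j, k - j))%N.
Proof.
move=> jk kn; have jn := leq_trans jk kn.
have := bin_fact kn; rewrite -(bin_fact jk) -(bin_fact jn).
have kj : (k - j <= n - j)%N by rewrite leq_sub2r.
rewrite -(bin_fact kj) (_ : n - j - (k - j) = n - k)%N; last by lia.
move=> e; have f0 : (0 < j`! * (k - j)`! * (n - k)`!)%N by rewrite !muln_gt0 !fact_gt0.
by apply/eqP; rewrite -(eqn_pmul2r f0); apply/eqP; move: e; lia.
Qed.

(** These factorial moments of the binomial weights serve twice: they expand
    monomials in Bernstein polynomials, and for j <= 2 they compute the variance
    needed for uniform approximation. *)
Lemma binomial_moment (R : comPzRingType) (x y : R) (n j : nat) : (j <= n)%N ->
  \sum_(k < n.+1) ('C(k, j)%:R * ('C(n, k)%:R * (x ^+ k * y ^+ (n - k))))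
  = 'C(n, j)%:R * (x ^+ j * (x + y) ^+ (n - j)).
Proof.
move=> jn.
rewrite -(big_mkord predT
  (fun k => 'C(k, j)%:R * ('C(n, k)%:R * (x ^+ k * y ^+ (n - k))))).
rewrite (@big_cat_nat _ _ _ j) ?leqW//= big_nat_cond big1 ?add0r; last first.
  by move=> i /andP[/andP[_ ij] _]; rewrite bin_small// mul0r.
rewrite -{1}(add0n j) big_addn subSn// big_mkord [x + y]addrC exprDn !mulr_sumr.
apply: eq_bigr => i _; have [ilt inj] := (ltn_ord i, leq_ord i).
rewrite mulrA -natrM mul_bin_subset ?leq_addl//; last by lia.
rewrite addnK natrM -mulr_natl exprD (_ : n - (i + j) = n - j - i)%N; last by lia.
ring.
Qed.

(** The Bernstein coefficients of a monomial approach its values at the nodes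
    k / n: each factor (k - i) / (n - i) of the ratio differs from k / n by at
    most i / n, and all factors lie in [0, 1]. *)
Lemma bin_ratio_bound (R : realType) (n k j : nat) :
  (j <= n)%N -> (k <= n)%N -> (0 < n)%N ->
  `|'C(k, j)%:R / 'C(n, j)%:R - (k%:R / n%:R) ^+ j| <= (j * j)%:R / n%:R :> R.
Proof.
move=> jn kn n0; have n0' : 0 < n%:R :> R by rewrite ltr0n.
elim: j jn => [|j IH] jn.
  by rewrite !bin0 divr1 expr0 subrr normr0 mul0n mul0r.
have Cn0 i : (i <= n)%N -> 0 < 'C(n, i)%:R :> R by move=> h; rewrite ltr0n bin_gt0.
have nj0 : 0 < (n - j)%:R :> R by rewrite ltr0n subn_gt0.
have [Cj Cj1] := (Cn0 j (ltnW jn), Cn0 _ jn).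
have ratioS : 'C(k, j.+1)%:R / 'C(n, j.+1)%:R =
    ('C(k, j)%:R / 'C(n, j)%:R) * ((k - j)%:R / (n - j)%:R) :> R.
  have S0 : j.+1%:R != 0 :> R by rewrite pnatr_eq0.
  have e i : j.+1%:R * 'C(i, j.+1)%:R = (i - j)%:R * 'C(i, j)%:R :> R.
    by rewrite -!natrM mul_bin_left.
  have ek := e k; have en := e n.
  rewrite mulf_div; apply/eqP.
  rewrite eqr_div; [|by rewrite gt_eqF|by rewrite gt_eqF// mulr_gt0].
  apply/eqP; apply: (mulfI S0); rewrite [LHS]mulrA ek.
  rewrite [RHS](_ : _ = (k - j)%:R * 'C(k, j)%:R * (j.+1%:R * 'C(n, j.+1)%:R)).
    by rewrite en; ring.
  by ring.
have ratio1 : 0 <= ('C(k, j)%:R / 'C(n, j)%:R : R) <= 1.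
  rewrite divr_ge0//= ler_pdivrMr// mul1r ler_nat.
  exact: leq_bin2l.
have kn1 : 0 <= (k%:R / n%:R : R) <= 1.
  by rewrite divr_ge0//= ler_pdivrMr// mul1r ler_nat.
have step : `|(k - j)%:R / (n - j)%:R - k%:R / n%:R| <= j%:R / n%:R :> R.
  rewrite ler_norml; apply/andP; split; last first.
    have : (k - j)%:R / (n - j)%:R <= k%:R / n%:R :> R.
      rewrite ler_pdivrMr// mulrAC ler_pdivlMr// -!natrM ler_nat; nia.
    have : 0 <= j%:R / n%:R :> R by rewrite divr_ge0.
    lra.
  rewrite lerBrDr addrC -mulrBl ler_pdivrMr//.
  have : (k - j)%:R / (n - j)%:R * (n - j)%:R <= (k - j)%:R / (n - j)%:R * n%:R :> R.
    by rewrite ler_wpM2l ?divr_ge0// ler_nat leq_subr.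
  rewrite divfK ?gt_eqF//; apply: le_trans.
  by rewrite lerBlDr -natrD ler_nat; lia.
rewrite ratioS exprS.
set r := _ / 'C(n, j)%:R in IH ratio1 *; set s := _ / (n - j)%:R in step *.
set z := k%:R / n%:R in IH kn1 step *.
have -> : r * s - z * z ^+ j = r * (s - z) + z * (r - z ^+ j) by ring.
apply: (le_trans (ler_normD _ _)); rewrite (normrM r) (normrM z).
have := IH (ltnW jn) => {}IH.
have h1 : `|r| * `|s - z| <= 1 * (j%:R / n%:R).
  by apply: ler_pM => //; rewrite ger0_norm; case/andP: ratio1.
have h2 : `|z| * `|r - z ^+ j| <= 1 * ((j * j)%:R / n%:R).
  by apply: ler_pM => //; rewrite ger0_norm; case/andP: kn1.
apply: (le_trans (lerD h1 h2)).
by rewrite !mul1r -mulrDl -natrD ler_pM2r ?invr_gt0// ler_nat mulSn mulnS leq_addl.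
Qed.

(** A modulus of continuity in a form that can be averaged: the quadratic term
    pays for the points far from x, and its mean against the Bernstein weights
    is a variance. *)
Lemma quadratic_modulus (R : realType) (f : R -> R) (a b e : R) : a <= b ->
  {within `[a, b], continuous f} -> 0 < e ->
  exists2 C, 0 <= C & forall x y, x \in `[a, b] -> y \in `[a, b] ->
    `|f y - f x| <= e + C * (y - x) ^+ 2.
Proof.
move=> ab fc e0.
have [S fS] : exists S, forall t, t \in `[a, b] -> `|f t| <= S.
  have nfc : {within `[a, b], continuous (fun t => `|f t|)}.
    by move=> x; apply: cvg_norm; exact: fc.
  by have [c _ ?] := EVT_max ab nfc; exists `|f c|.
pose P C x := x \in `[a, b] -> forall y, y \in `[a, b] ->
  `|f y - f x| <= e + C * (y - x) ^+ 2.
have /compact_near_coveringP/(_ R +oo P _) cov := @segment_compact R a b.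
have {}cov : \forall C \near +oo, `[a, b]%classic `<=` P C.
  apply: cov => x abx.
  have /subspace_continuousP/(_ x abx)/cvgrPdist_le/(_ (e / 2)) := fc.
  rewrite divr_gt0// => /(_ isT); rewrite near_withinE => /nbhs_ballP[d /= d0 xd].
  have d20 : 0 < d / 2 by rewrite divr_gt0.
  exists (ball x (d / 2), [set C | 2 * S / (d / 2) ^+ 2 <= C]) => /=.
    split; [exact: nbhsx_ballx | by apply: nbhs_pinfty_ge; rewrite num_real].
  move=> [x' C] /= [xx' SC] abx' y aby.
  have C0 : 0 <= C.
    apply: le_trans SC; rewrite divr_ge0 ?exprn_ge0 ?(ltW d20)// mulr_ge0//.
    exact: le_trans (fS _ aby).
  have xx'd : ball x d x' by apply: le_ball xx'; lra.
  have [yxd|] := ltP `|x - y| d.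
    have -> : f y - f x' = (f x - f x') - (f x - f y) by ring.
    apply: (le_trans (ler_normB _ _)).
    have := xd _ xx'd abx'; have := xd y yxd aby.
    have : 0 <= C * (y - x') ^+ 2 by rewrite mulr_ge0 ?sqr_ge0.
    lra.
  move=> dxy.
  have d2y : d / 2 <= `|y - x'|.
    have : `|x - y| <= `|x - x'| + `|y - x'|.
      by rewrite -[`|y - x'|]normrN opprB (le_trans _ (ler_normD _ _))// addrA subrK.
    move: xx'; rewrite /ball/= => xx'; lra.
  have sq : (d / 2) ^+ 2 <= (y - x') ^+ 2.
    by rewrite -[leRHS]real_normK ?num_real// lerXn2r ?nnegrE// ltW.
  have : 2 * S <= C * (y - x') ^+ 2.
    apply: (@le_trans _ _ (C * (d / 2) ^+ 2)); last by rewrite ler_wpM2l.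
    by rewrite -ler_pdivrMr// exprn_gt0.
  have := ler_normB (f y) (f x'); have := fS _ aby; have := fS _ abx'.
  lra.
have [C [abC C0]] : exists C, `[a, b]%classic `<=` P C /\ 0 <= C.
  by apply: (@filter_ex _ (+oo : set_system R)); apply: filterI => //; apply: nbhs_pinfty_ge; rewrite num_real.
by exists C => // x y abx aby; exact: abC.
Qed.

(** Homogenized in M instead of rescaled to [0, 1], so that the substitution of
    an operator for the variable involves no division. *)
Definition bernstein {R : comNzRingType} (M : R) (n k : nat) : {poly R} :=
  'C(n, k)%:R *: ('X^k * (M%:P - 'X) ^+ (n - k)).

Lemma bernstein_moment (R : comNzRingType) (M : R) (n j : nat) : (j <= n)%N ->
  \sum_(k < n.+1) 'C(k, j)%:R *: bernstein M n k
  = ('C(n, j)%:R * M ^+ (n - j)) *: 'X^j.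
Proof.
move=> jn; rewrite -[in RHS]scalerA !scaler_nat -mul_polyC polyC_exp mulrC.
have := binomial_moment 'X (M%:P - 'X) jn; rewrite (addrC 'X) subrK.
rewrite mulr_natl => <-; apply: eq_bigr => k _.
by rewrite /bernstein !scaler_nat !mulr_natl.
Qed.

Lemma bernstein_ge0 (R : realType) (M t : R) (n k : nat) :
  t \in `[0, M] -> 0 <= (bernstein M n k).[t].
Proof.
rewrite in_itv/= => /andP[t0 tM]; rewrite /bernstein hornerZ hornerM !horner_exp.
by rewrite hornerD hornerN hornerC !hornerX !mulr_ge0// exprn_ge0// subr_ge0.
Qed.

Lemma bernstein_variance (R : realType) (M t : R) (n : nat) : 0 < M -> (1 < n)%N ->
  \sum_(k < n.+1) (M * (k%:R / n%:R) - t) ^+ 2 * (bernstein M n k).[t]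
  = M ^+ n * (t * (M - t) / n%:R).
Proof.
move=> M0 n1; have n0 : n%:R != 0 :> R by rewrite pnatr_eq0; lia.
have moment j : (j <= n)%N ->
    \sum_(k < n.+1) 'C(k, j)%:R * (bernstein M n k).[t]
    = 'C(n, j)%:R * M ^+ (n - j) * t ^+ j.
  move=> jn; have /(congr1 (horner^~ t)) := bernstein_moment M jn.
  rewrite hornerZ hornerXn => <-; rewrite horner_sum.
  by apply: eq_bigr => k _; rewrite [RHS]hornerZ.
have bin2E k : (2 * 'C(k, 2)%:R = k%:R ^+ 2 - k%:R :> R).
  have : (2 * 'C(k, 2) + k = k ^ 2)%N.
    by rewrite bin2 mul2n halfK; case: k => //= k; rewrite !oddM /= andNb subn0; lia.
  by move=> /(congr1 (fun i => i%:R : R)); rewrite natrD natrM natrX => <-; rewrite addrK.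
have expand (k : 'I_n.+1) : (M * (k%:R / n%:R) - t) ^+ 2 * (bernstein M n k).[t] =
    (M / n%:R) ^+ 2 * 2 * ('C(k, 2)%:R * (bernstein M n k).[t])
    + ((M / n%:R) ^+ 2 - 2 * t * M / n%:R) * ('C(k, 1)%:R * (bernstein M n k).[t])
    + t ^+ 2 * ('C(k, 0)%:R * (bernstein M n k).[t]).
  have k2 : k%:R ^+ 2 = 2 * 'C(k, 2)%:R + k%:R :> R by rewrite bin2E subrK.
  rewrite bin1 bin0 mul1r.
  rewrite [LHS](_ : _ = ((M / n%:R) ^+ 2 * k%:R ^+ 2
    - 2 * t * M / n%:R * k%:R + t ^+ 2) * (bernstein M n k).[t]); last by ring.
  by rewrite k2; ring.
rewrite (eq_bigr _ (fun k _ => expand k)) !big_split/= -!mulr_sumr !moment//; last lia.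
have -> : (n = (n - 2).+2)%N by lia.
set p := (n - 2)%N; have p0 : p.+2%:R != 0 :> R by rewrite pnatr_eq0.
have -> : (p.+2 - 2 = p)%N by lia.
have -> : (p.+2 - 1 = p.+1)%N by lia.
rewrite subn0 bin1 bin0 (_ : (M / p.+2%:R) ^+ 2 * 2 * _ =
  (M / p.+2%:R) ^+ 2 * (2 * 'C(p.+2, 2)%:R) * M ^+ p * t ^+ 2); last by ring.
by rewrite bin2E !exprS; field.
Qed.

Theorem weierstrass_approximation (R : realType) (f : R -> R) (M e : R) : 0 < M ->
  {within `[0, M], continuous f} -> 0 < e ->
  exists p : {poly R}, forall t, t \in `[0, M] -> `|f t - p.[t]| <= e.
Proof.
move=> M0 fc e0; have e20 : 0 < e / 2 by rewrite divr_gt0.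
have [C C0 fC] := quadratic_modulus (ltW M0) fc e20.
pose n := (Num.trunc (2 * C * M ^+ 2 / e)).+2.
have n0 : 0 < n%:R :> R by rewrite ltr0n.
have nC : 2 * C * M ^+ 2 / e <= n%:R.
  apply: ltW (lt_trans (truncnS_gt _) _); by rewrite ltr_nat.
have Mn0 : 0 < M ^+ n by rewrite exprn_gt0.
exists ((M ^+ n)^-1 *: \sum_(k < n.+1) f (M * (k%:R / n%:R)) *: bernstein M n k).
move=> t tM; pose b (k : nat) := (bernstein M n k).[t].
have b0 k : 0 <= b k by exact: bernstein_ge0.
have sumb : \sum_(k < n.+1) b k = M ^+ n.
  have /(congr1 (horner^~ t)) := bernstein_moment M (leq0n n).
  rewrite bin0 subn0 mul1r expr0 hornerZ hornerC mulr1 => <-.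
  by rewrite horner_sum; apply: eq_bigr => k _; rewrite bin0 scale1r.
rewrite hornerZ horner_sum -(ler_pM2l Mn0) -[X in X * `|_|]gtr0_norm// -normrM.
rewrite mulrBr mulrA divff ?gt_eqF// mul1r -{1}sumb mulr_suml -sumrB.
apply: (le_trans (ler_norm_sum _ _ _)).
have tbound : t * (M - t) <= M ^+ 2.
  by move: tM; rewrite in_itv/= => /andP[? ?]; nra.
have Cn : C * (t * (M - t) / n%:R) <= e / 2.
  rewrite mulrA ler_pdivrMr//; move: nC; rewrite ler_pdivrMr//.
  have : C * (t * (M - t)) <= C * M ^+ 2 by rewrite ler_wpM2l.
  lra.
apply: (@le_trans _ _ (\sum_(k < n.+1) (e / 2 * b k
    + C * ((M * (k%:R / n%:R) - t) ^+ 2 * b k)))).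
  apply: ler_sum => k _; rewrite hornerZ -/(b k) (mulrC (b k)) -mulrBl normrM (ger0_norm (b0 k)).
  rewrite (mulrA C) -mulrDl ler_wpM2r// distrC; apply: fC => //.
  rewrite in_itv/= mulr_ge0 ?divr_ge0 ?(ltW M0)//= ler_piMr ?(ltW M0)//.
  by rewrite ler_pdivrMr// mul1r ler_nat leq_ord.
rewrite big_split/= -!mulr_sumr sumb bernstein_variance// (mulrCA C) (mulrC (e / 2)) -mulrDr.
by rewrite ler_wpM2l ?(ltW Mn0)//; lra.
Qed.

(** * Inner products *)

Section InnerProduct.
Variables (R : realType) (X : hilbertType R).
Implicit Types (u v w : X) (c : R).

Lemma dotDl u v w : dot (u + v) w = dot u w + dot v w.
Proof. by have := dotP 1 u v w; rewrite scale1r mul1r. Qed.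

Lemma dot0l w : dot 0 w = 0.
Proof. by apply: (addrI (dot 0 w)); rewrite -dotDl !addr0. Qed.

Lemma dotZl c u w : dot (c *: u) w = c * dot u w.
Proof. by have := dotP c u 0 w; rewrite dot0l !addr0. Qed.

Lemma dotNl u w : dot (- u) w = - dot u w.
Proof. by rewrite -scaleN1r dotZl mulN1r. Qed.

Lemma dotBl u v w : dot (u - v) w = dot u w - dot v w.
Proof. by rewrite dotDl dotNl. Qed.

Lemma dotDr u v w : dot w (u + v) = dot w u + dot w v.
Proof. by rewrite dotC dotDl !(dotC w). Qed.

Lemma dotZr c u w : dot w (c *: u) = c * dot w u.
Proof. by rewrite dotC dotZl (dotC w). Qed.

Lemma dotBr u v w : dot w (u - v) = dot w u - dot w v.
Proof. by rewrite dotC dotBl !(dotC w). Qed.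

Lemma dot_suml (I : Type) (r : seq I) (P : pred I) (F : I -> X) w :
  dot (\sum_(i <- r | P i) F i) w = \sum_(i <- r | P i) dot (F i) w.
Proof.
by apply: (big_morph (fun x => dot x w)) => [u v|]; rewrite ?dotDl ?dot0l.
Qed.

Lemma cauchy_schwarz u v : `|dot u v| <= `|u| * `|v|.
Proof.
have [->|v0] := eqVneq v 0.
  by rewrite dotC dot0l !normr0 mulr0.
have nv : 0 < `|v| ^+ 2 by rewrite exprn_gt0// normr_gt0.
rewrite -ler_sqr ?nnegrE ?mulr_ge0// real_normK ?num_real// exprMn.
pose z := `|v| ^+ 2 *: u - dot u v *: v.
have : 0 <= dot z z by rewrite dotxx sqr_ge0.
rewrite /z !(dotBl, dotBr, dotZl, dotZr) !dotxx (dotC v u).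
set nu := `|u| ^+ 2; set nv2 := `|v| ^+ 2 in nv *; set b := dot u v => h.
have : 0 <= nv2 * (nu * nv2 - b ^+ 2).
  by lra.
by rewrite pmulr_rge0// subr_ge0.
Qed.

Lemma dot_cvgl (x_ : nat -> X) x u :
  x_ n @[n --> \oo] --> x -> dot (x_ n) u @[n --> \oo] --> dot x u.
Proof.
move=> /cvgrPdist_le xx; apply/cvgrPdist_le => e e0.
have nu : 0 < `|u| + 1 by rewrite ltr_wpDl.
have /xx : 0 < e / (`|u| + 1) by rewrite divr_gt0.
apply: filterS => n; rewrite ler_pdivlMr// => xn.
rewrite -dotBl; apply: le_trans (cauchy_schwarz _ _) _; apply: le_trans xn.
by rewrite ler_wpM2l// lerDl.
Qed.

End InnerProduct.

Arguments dot_cvgl {R X x_ x} u.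

(** * Polynomials of a positive operator *)

Section PolyOp.
Variables (R : realType) (X : hilbertType R) (T : {linear X -> X}).
Implicit Types (p q : {poly R}) (u v : X).

Lemma iter_is_linear n : linear (iter n T).
Proof. by elim: n => [|n IH] c u v //=; rewrite IH linearP. Qed.

Lemma poly_opE n p u : (size p <= n)%N ->
  poly_op p T u = \sum_(i < n) p`_i *: iter i T u.
Proof.
move=> pn; rewrite /poly_op (big_ord_widen n (fun i => p`_i *: iter i T u))//.
rewrite big_mkcond; apply: eq_bigr => i _; case: ifP => // /negbT.
by rewrite -leqNgt => h; rewrite nth_default// scale0r.
Qed.

Lemma poly_opP c p q u :
  poly_op (c *: p + q) T u = c *: poly_op p T u + poly_op q T u.
Proof.
pose n := maxn (maxn (size p) (size q)) (size (c *: p + q)).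
rewrite !(@poly_opE n) ?leq_max ?leqnn ?orbT// scaler_sumr -big_split.
by apply: eq_bigr => i _; rewrite coefD coefZ scalerDl scalerA.
Qed.

Lemma poly_opC c u : poly_op c%:P T u = c *: u.
Proof. by rewrite (@poly_opE 1) ?size_polyC_leq1// big_ord1 coefC. Qed.

Lemma poly_opD p q u : poly_op (p + q) T u = poly_op p T u + poly_op q T u.
Proof. by have := poly_opP 1 p q u; rewrite !scale1r. Qed.

Lemma poly_opZ c p u : poly_op (c *: p) T u = c *: poly_op p T u.
Proof. by have := poly_opP c p 0 u; rewrite -polyC0 poly_opC scale0r !addr0. Qed.

Lemma poly_opB p q u : poly_op (p - q) T u = poly_op p T u - poly_op q T u.
Proof. by rewrite poly_opD -scaleN1r poly_opZ scaleN1r. Qed.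

Lemma poly_op_sum (I : Type) (r : seq I) (F : I -> {poly R}) u :
  poly_op (\sum_(i <- r) F i) T u = \sum_(i <- r) poly_op (F i) T u.
Proof.
apply: (big_morph (fun p => poly_op p T u)) => [p q|]; first exact: poly_opD.
by rewrite -polyC0 poly_opC scale0r.
Qed.

Lemma poly_opMX p u : poly_op (p * 'X) T u = poly_op p T (T u).
Proof.
rewrite (@poly_opE (size p).+1); last first.
  by rewrite (leq_trans (size_polyMleq _ _))// size_polyX addn2.
rewrite big_ord_recl coefMX/= scale0r add0r; apply: eq_bigr => i _.
by rewrite coefMX/= -iterSr.
Qed.

Lemma poly_opX u : poly_op 'X T u = T u.
Proof. by rewrite -[X in poly_op X]mul1r poly_opMX -polyC1 poly_opC scale1r. Qed.

Lemma poly_op_is_linear p : linear (poly_op p T).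
Proof.
move=> c u v; rewrite /poly_op scaler_sumr -big_split; apply: eq_bigr => i _.
by rewrite iter_is_linear scalerDr !scalerA mulrC.
Qed.

HB.instance Definition _ p :=
  GRing.isLinear.Build R X X *:%R (poly_op p T) (poly_op_is_linear p).

Lemma poly_opM p q u : poly_op (p * q) T u = poly_op p T (poly_op q T u).
Proof.
elim/poly_ind: q u => [|q c IH] u.
  by rewrite mulr0 -polyC0 !poly_opC !scale0r linear0.
rewrite mulrDr poly_opD mulrA poly_opMX IH mulrC mul_polyC poly_opZ.
by rewrite poly_opD poly_opMX poly_opC linearD linearZ.
Qed.

End PolyOp.

(** Boundedness is part of the predicate because [opnorm], a supremum, only
    means something for bounded operators. *)
Definition psd_op (R : realType) (X : hilbertType R) (T : {linear X -> X}) : Prop :=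
  [/\ forall u v, dot (T u) v = dot u (T v), forall u, 0 <= dot (T u) u
    & exists M, forall u, `|T u| <= M * `|u|].

Section PsdPoly.
Variables (R : realType) (X : hilbertType R) (T : {linear X -> X}).
Hypothesis psdT : psd_op T.
Implicit Types (p q : {poly R}) (u v : X).

Lemma poly_op_sym p u v : dot (poly_op p T u) v = dot u (poly_op p T v).
Proof.
have [symT _ _] := psdT.
elim/poly_ind: p u v => [|p c IH] u v.
  by rewrite -polyC0 !poly_opC !scale0r dot0l dotC dot0l.
rewrite !poly_opD !poly_opC dotDl dotDr dotZl dotZr; congr (_ + _).
by rewrite poly_opMX IH symT mulrC poly_opM poly_opX.
Qed.

Lemma opnormP :
  0 <= opnorm T /\ forall u, `|T u| <= opnorm T * `|u|.
Proof.
have [_ _ [M TM]] := psdT.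
have hs : has_sup [set `|T u| | u in [set u : X | `|u| <= 1]].
  split; first by exists `|T 0|, 0 => //=; rewrite normr0.
  exists `|M| => _ [u /= u1 <-]; apply: (le_trans (TM u)).
  apply: (le_trans (ler_norm _)); rewrite normrM normr_id.
  by rewrite ler_piMr.
have ub u : `|u| <= 1 -> `|T u| <= opnorm T.
  by move=> u1; apply: sup_upper_bound => //; exists u.
split; first by have := ub 0; rewrite linear0 !normr0; apply.
move=> u; have [->|u0] := eqVneq u 0; first by rewrite linear0 !normr0 mulr0.
have nu : 0 < `|u| by rewrite normr_gt0.
have := ub (`|u|^-1 *: u); rewrite linearZ !normrZ normfV normr_id.
rewrite mulVf ?gt_eqF// => /(_ (lexx _)).
by rewrite mulrC ler_pdivrMr.
Qed.

Let psd p := forall u, 0 <= dot (poly_op p T u) u.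

Let psdD p q : psd p -> psd q -> psd (p + q).
Proof. by move=> hp hq u; rewrite poly_opD dotDl addr_ge0. Qed.

Let psdZ c p : 0 <= c -> psd p -> psd (c *: p).
Proof. by move=> c0 hp u; rewrite poly_opZ dotZl mulr_ge0. Qed.

Let psd_sqrM q p : psd p -> psd (q ^+ 2 * p).
Proof.
move=> hp u; rewrite expr2 -mulrA poly_opM poly_op_sym mulrC poly_opM.
exact: hp.
Qed.

(** After even powers are extracted as squares, only the four products of T and
    M - T with exponents 0 or 1 remain. The mixed one is reduced to squares by
    M T (M - T) = T (M - T) T + (M - T) T (M - T). *)
Let psd_bernstein M n k : 0 < M -> opnorm T <= M -> psd (bernstein M n k).
Proof.
move=> M0 TM; have [_ posT _] := psdT; have [_ leT] := opnormP.
have psd1 : psd 1 by move=> u; rewrite -polyC1 poly_opC scale1r dotxx sqr_ge0.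
have psdX : psd 'X by move=> u; rewrite poly_opX.
have psdMX : psd (M%:P - 'X).
  move=> u; rewrite poly_opB poly_opC poly_opX dotBl dotZl dotxx subr_ge0.
  apply: (le_trans (ler_norm _)); apply: (le_trans (cauchy_schwarz _ _)).
  by rewrite expr2 mulrA ler_wpM2r// (le_trans (leT u))// ler_wpM2r.
have psdXMX : psd ('X * (M%:P - 'X)).
  have -> : 'X * (M%:P - 'X) =
      M^-1 *: ('X ^+ 2 * (M%:P - 'X) + (M%:P - 'X) ^+ 2 * 'X).
    rewrite (_ : _ + _ = M%:P * ('X * (M%:P - 'X))); last by ring.
    by rewrite mul_polyC scalerA mulVf ?gt_eqF// scale1r.
  apply: psdZ; first by rewrite invr_ge0 ltW.
  by apply: psdD; apply: psd_sqrM.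
rewrite /bernstein; apply: psdZ => //; move: (n - k)%N => j.
have parity (q : {poly R}) i : q ^+ i = (q ^+ i./2) ^+ 2 * q ^+ odd i.
  by rewrite -exprM muln2 -exprD addnC odd_double_half.
rewrite (parity 'X k) (parity (M%:P - 'X) j).
rewrite mulrACA -exprMn.
apply: psd_sqrM; case: (odd k); case: (odd j);
  by rewrite ?expr0 ?expr1 ?mul1r ?mulr1.
Qed.

(** The k-th coefficient of p in the Bernstein basis of degree n differs from
    p(M k / n) by O(1 / n), uniformly in k. Hence p + e has nonnegative
    coefficients for large n, and each Bernstein polynomial of T is positive. *)
Lemma poly_op_ge0 p u : (forall t, t \in `[0, opnorm T] -> 0 <= p.[t]) ->
  0 <= dot (poly_op p T u) u.
Proof.
move=> p0; have [N0 leT] := opnormP; set M := opnorm T in p0 N0 leT.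
(* When |T| = 0 there is no interval to rescale to, but p(T) = p(0). *)
move: N0; rewrite le_eqVlt => /predU1P[M0|M0].
  have Tu : T u = 0.
    by apply/eqP; rewrite -normr_le0; apply: le_trans (leT u) _; rewrite -M0 mul0r.
  have := p0 0; rewrite in_itv/= -M0 !lexx => /(_ isT).
  elim/poly_ind: p {p0} => [|q c _]; first by rewrite -polyC0 poly_opC scale0r dot0l.
  rewrite hornerMXaddC mulr0 add0r poly_opD poly_opMX Tu linear0 add0r poly_opC => c0.
  by rewrite dotZl dotxx mulr_ge0// sqr_ge0.
suff psde e : 0 < e -> psd (p + e%:P).
  apply/ler_addgt0Pr => e e0; have nu : 0 < `|u| ^+ 2 + 1 by rewrite ltr_wpDl ?sqr_ge0.
  have /psde/(_ u) : 0 < e / (`|u| ^+ 2 + 1) by rewrite divr_gt0.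
  rewrite poly_opD poly_opC dotDl dotZl dotxx => h; apply: (le_trans h).
  rewrite lerD2l mulrAC ler_pdivrMr// ler_wpM2l ?(ltW e0)//.
  by rewrite lerDl.
move=> e0.
pose S := \sum_(j < size p) `|p`_j| * M ^+ j * (j * j)%:R.
pose n := maxn (size p) (Num.trunc (S / e)).+1.
have n0 : (0 < n)%N by rewrite leq_max orbT.
have nR0 : 0 < n%:R :> R by rewrite ltr0n.
have Sn : S / n%:R <= e.
  rewrite ler_pdivrMr// mulrC -ler_pdivrMr//.
  by apply: le_trans (ltW (truncnS_gt _)) _; rewrite ler_nat leq_maxr.
pose c k := \sum_(j < size p) p`_j * M ^+ j * ('C(k, j)%:R / 'C(n, j)%:R).
have jn (j : 'I_(size p)) : (j <= n)%N.
  by rewrite (leq_trans (ltnW (ltn_ord j)))// leq_maxl.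
have c0 k : (k <= n)%N -> 0 <= c k + e.
  move=> kn; have : 0 <= p.[M * (k%:R / n%:R)].
    apply: p0; rewrite in_itv/= mulr_ge0 ?divr_ge0 ?(ltW M0)//= ler_piMr ?(ltW M0)//.
    by rewrite ler_pdivrMr// mul1r ler_nat.
  have : `|c k - p.[M * (k%:R / n%:R)]| <= e.
    apply: le_trans Sn; rewrite horner_coef /c -sumrB mulr_suml.
    apply: le_trans (ler_norm_sum _ _ _) _; apply: ler_sum => j _.
    rewrite exprMn [X in `|_ - X|]mulrA -mulrBr normrM normrM (ger0_norm (exprn_ge0 _ (ltW M0))) -[leRHS]mulrA.
    by rewrite ler_wpM2l ?mulr_ge0 ?exprn_ge0 ?(ltW M0)//; apply: bin_ratio_bound.
  by rewrite ler_norml => /andP[]; lra.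
have psdMn : psd (M ^+ n *: (p + e%:P)).
  suff -> : M ^+ n *: (p + e%:P) = \sum_(k < n.+1) (c k + e) *: bernstein M n k.
    move=> v; rewrite poly_op_sum dot_suml; apply: sumr_ge0 => k _.
    by apply: psdZ; [apply: c0; exact: leq_ord | exact: psd_bernstein].
  under eq_bigr do rewrite scalerDl.
  rewrite big_split/= -scaler_sumr scalerDr; congr (_ + _); last first.
    have := bernstein_moment M (leq0n n); rewrite bin0 mul1r subn0 expr0 alg_polyC.
    under eq_bigr do rewrite bin0 scale1r.
    by move=> ->; rewrite -!mul_polyC mulrC.
  under eq_bigr do rewrite /c scaler_suml.
  rewrite exchange_big/= -[in LHS](coefK p) poly_def scaler_sumr; apply: eq_bigr => j _.
  have Cn0 : 'C(n, j)%:R != 0 :> R by rewrite pnatr_eq0 -lt0n bin_gt0.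
  transitivity ((p`_j * M ^+ j / 'C(n, j)%:R) *:
      \sum_(k < n.+1) 'C(k, j)%:R *: bernstein M n k).
    rewrite bernstein_moment// !scalerA; congr (_ *: _).
    by rewrite -{1}(subnK (jn j)) exprD; field.
  by rewrite scaler_sumr; apply: eq_bigr => k _; rewrite scalerA; congr (_ *: _); ring.
have := psdZ _ psdMn; move=> /(_ (M ^+ n)^-1).
by rewrite scalerA mulVf ?scale1r ?gt_eqF ?exprn_gt0//; apply; rewrite invr_ge0 exprn_ge0// ltW.
Qed.

(** If |p| <= c on the interval, then c^2 - p^2 is nonnegative there, and its
    value at T has quadratic form c^2 |u|^2 - |p(T) u|^2. *)
Lemma poly_op_norm_le p c u : 0 <= c ->
  (forall t, t \in `[0, opnorm T] -> `|p.[t]| <= c) -> `|poly_op p T u| <= c * `|u|.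
Proof.
move=> c0 pc; rewrite -ler_sqr ?nnegrE ?mulr_ge0// exprMn -!dotxx.
have : 0 <= dot (poly_op ((c ^+ 2)%:P - p * p) T u) u.
  apply: poly_op_ge0 => t /pc pt; rewrite hornerD hornerN hornerM hornerC subr_ge0.
  by rewrite -expr2 -(real_normK (num_real p.[t])) lerXn2r ?nnegrE.
rewrite poly_opB poly_opC poly_opM dotBl dotZl (poly_op_sym p _ u).
by rewrite subr_ge0.
Qed.

End PsdPoly.

(** * Continuity and polynomial approximation on the half-line *)

Lemma uniform_cvgP (R : realType) (A : set R) (p_ : nat -> R -> R) (f : R -> R) :
  {uniform A, p_ @ \oo --> f} <->
  forall e, 0 < e -> \forall n \near \oo, forall t, A t -> `|f t - p_ n t| <= e.
Proof.
split=> [pf e e0|pf P /uniform_nbhs[E [entE EP]]].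
  apply: (pf [set h | forall t, A t -> `|f t - h t| <= e]).
  apply/uniform_nbhs; exists [set xy | ball xy.1 e xy.2]; split.
    by rewrite -entourage_ballE; exists e.
  by move=> h /= hE t /hE; exact: ltW.
have [e /= e0 eE] : exists2 e : R, 0 < e & [set xy | ball xy.1 e xy.2] `<=` E.
  by move: entE; rewrite -entourage_ballE => -[e /= e0 eE]; exists e.
have e20 : 0 < e / 2 by rewrite divr_gt0.
apply: filterS (pf _ e20) => n pn; apply: EP => t At; apply: eE => /=.
by rewrite /ball/=; apply: le_lt_trans (pn t At) _; lra.
Qed.

Lemma cvg_of_cauchy (R : realType) (X : completeNormedModType R) (x_ : nat -> X) :
  (forall e, 0 < e -> exists n0, forall n, (n0 <= n)%N -> `|x_ n0 - x_ n| <= e) ->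
  cvg (x_ n @[n --> \oo]).
Proof.
move=> cx; apply/cauchy_cvgP/cauchy_exP => e e0.
have [n0 n0P] : exists n0, forall n, (n0 <= n)%N -> `|x_ n0 - x_ n| <= e / 2.
  by apply: cx; rewrite divr_gt0.
exists (x_ n0); exists n0 => //= n /= nn0.
by rewrite -ball_normE /=; apply: le_lt_trans (n0P _ nn0) _; lra.
Qed.

Section NnegContinuous.
Variable R : realType.
Implicit Types (f g : R -> R).

(** The half-line rather than the interval given by one operator norm: the
    functions of interest can then be composed and transferred from A to A^r
    without comparing the norms of the two operators. *)
Definition nneg_continuous f : Prop := {within `[0, +oo[, continuous f}.

Lemma nneg_continuousD f g : nneg_continuous f -> nneg_continuous g ->
  nneg_continuous (fun t => f t + g t).
Proof. by move=> fc gc x; apply: cvgD; [exact: fc | exact: gc]. Qed.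

Lemma nneg_continuousM f g : nneg_continuous f -> nneg_continuous g ->
  nneg_continuous (fun t => f t * g t).
Proof. by move=> fc gc x; apply: cvgM; [exact: fc | exact: gc]. Qed.

Lemma nneg_continuous_cst c : nneg_continuous (fun _ => c).
Proof. by move=> x; exact: cvg_cst. Qed.

Lemma nneg_continuousV f : nneg_continuous f -> (forall t, 0 <= t -> 0 < f t) ->
  nneg_continuous (fun t => (f t)^-1).
Proof.
move=> /subspace_continuousP fc f0; apply/subspace_continuousP => x x0.
apply: cvgV; last exact: fc.
by rewrite gt_eqF// f0//; move: x0; rewrite /= in_itv/= andbT.
Qed.

Lemma nneg_continuous_horner (p : {poly R}) : nneg_continuous (fun t => p.[t]).
Proof. by apply: continuous_subspaceT => x; exact: continuous_horner. Qed.

Lemma nneg_continuous_comp f g : nneg_continuous f -> nneg_continuous g ->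
  (forall t, 0 <= t -> 0 <= g t) -> nneg_continuous (fun t => f (g t)).
Proof.
move=> /subspace_continuousP fc /subspace_continuousP gc g0.
have nnegE (t : R) : `[0, +oo[%classic t = (0 <= t) :> Prop.
  by rewrite /= in_itv/= andbT.
apply/subspace_continuousP => x x0.
have gx0 : `[0, +oo[%classic (g x) by rewrite nnegE g0// -nnegE.
apply: cvg_comp (fc _ gx0) => P gP.
have : nbhs x (fun t => `[0, +oo[%classic t -> `[0, +oo[%classic (g t) -> P (g t)).
  exact: gc x x0 _ gP.
apply: filterS => t gtP t0; apply: gtP => //.
by rewrite nnegE g0// -nnegE.
Qed.

Lemma nneg_continuous_powR s : 0 < s -> nneg_continuous (fun t => t `^ s).
Proof.
move=> s0; apply/continuous_within_itvcyP; split; last first.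
  by rewrite powR0 ?gt_eqF//; exact: powR_cvg0.
move=> x; rewrite in_itv/= andbT => x0.
by apply: differentiable_continuous; apply/derivable1_diffP; apply: derivable_powR; rewrite in_itv/= andbT.
Qed.

Lemma nneg_continuous_bounded f N : nneg_continuous f ->
  exists2 c, 0 <= c & forall t, t \in `[0, N] -> `|f t| <= c.
Proof.
move=> fc; have [N0|N0] := leP 0 N; last first.
  by exists 0 => // t; rewrite in_itv/= => /andP[t0 tN]; lra.
have fcN : {within `[0, N], continuous (fun t => `|f t|)}.
  have sub : `[0, N] `<=` `[0, +oo[%classic.
    by move=> t /=; rewrite !in_itv/= andbT => /andP[].
  by move=> x; apply: cvg_norm; exact: (continuous_subspaceW sub fc).
by have [c _ ?] := EVT_max N0 fcN; exists `|f c|.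
Qed.

Lemma nneg_continuous_approx f N e : nneg_continuous f -> 0 < e ->
  exists p : {poly R}, forall t, t \in `[0, N] -> `|f t - p.[t]| <= e.
Proof.
move=> fc e0; have N0 : 0 < `|N| + 1 by rewrite ltr_wpDl.
have fcN : {within `[0, `|N| + 1], continuous f}.
  apply: continuous_subspaceW fc => t /=.
  by rewrite !in_itv/= andbT => /andP[].
have [p fp] := weierstrass_approximation N0 fcN e0.
exists p => t; rewrite in_itv/= => /andP[t0 tN]; apply: fp; rewrite in_itv/= t0/=.
by rewrite (le_trans tN)// (le_trans (ler_norm _))// lerDl.
Qed.

End NnegContinuous.

Arguments nneg_continuous_cst {R} c.
Arguments nneg_continuous_horner {R} p.

(** * Spectral calculus *)

Lemma eq_of_norm_le (R : realType) (X : normedModType R) (x y : X) (C : R) :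
  (forall e, 0 < e -> `|x - y| <= e * C) -> x = y.
Proof.
move=> xy; apply/eqP; rewrite -subr_eq0 -normr_le0; apply/ler_addgt0Pr => e e0.
have C0 : 0 < `|C| + 1 by rewrite ltr_wpDl.
have /xy : 0 < e / (`|C| + 1) by rewrite divr_gt0.
move=> h; rewrite add0r; apply: le_trans h _; rewrite mulrAC ler_pdivrMr//.
by rewrite ler_wpM2l ?(ltW e0)// (le_trans (ler_norm _))// lerDl.
Qed.

Section Calculus.
Variables (R : realType) (X : hilbertType R) (T : {linear X -> X}).
Hypothesis psdT : psd_op T.
Implicit Types (f g : R -> R) (p : {poly R}) (u v : X).

(** This characterizes f(T): it determines [spectral_calc T f u] as the limit of
    any polynomial approximation, and every rule of the calculus below is read
    off from it. *)
Lemma calc_close f p e u : nneg_continuous f ->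
  (forall t, t \in `[0, opnorm T] -> `|f t - p.[t]| <= e) ->
  `|spectral_calc T f u - poly_op p T u| <= e * `|u|.
Proof.
move=> fc fp; set N := opnorm T in fp; have [N0 _] := opnormP psdT.
have dist q1 q2 e1 e2 : (forall t, t \in `[0, N] -> `|f t - q1.[t]| <= e1) ->
    (forall t, t \in `[0, N] -> `|f t - q2.[t]| <= e2) ->
    `|poly_op q1 T u - poly_op q2 T u| <= (e1 + e2) * `|u|.
  move=> fq1 fq2; rewrite -poly_opB; have zN : 0 \in `[0, N] by rewrite in_itv/= lexx.
  apply: poly_op_norm_le => //.
    have := le_trans (normr_ge0 _) (fq1 _ zN); have := le_trans (normr_ge0 _) (fq2 _ zN).
    lra.
  move=> t tN; rewrite hornerD hornerN.
  rewrite (_ : _ - _ = (f t - q2.[t]) - (f t - q1.[t])); last by ring.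
  by apply: le_trans (ler_normB _ _) _; have := fq1 _ tN; have := fq2 _ tN; lra.
have /choice[p_ p_f] : forall n : nat, exists q : {poly R},
    forall t, t \in `[0, N] -> `|f t - q.[t]| <= n.+1%:R^-1.
  by move=> n; apply: nneg_continuous_approx.
have inv_small (e' : R) : 0 < e' -> \forall n \near \oo, n.+1%:R^-1 <= e'.
  move=> e'0; have := near_infty_natSinv_lt (PosNum e'0).
  by apply: filterS => n /ltW.
have ex : exists v, exists p_ : nat -> {poly R},
    {uniform `[0, N], (fun n x => (p_ n).[x]) @ \oo --> f} /\
    poly_op (p_ n) T u @[n --> \oo] --> v.
  have cau : cvg (poly_op (p_ n) T u @[n --> \oo]).
    apply: cvg_of_cauchy => e' e'0; have nu : 0 < `|u| + 1 by rewrite ltr_wpDl.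
    have e'2 : 0 < e' / 2 / (`|u| + 1) by rewrite !divr_gt0.
    have [n0 _ n0P] := inv_small _ e'2; exists n0 => n nn0.
    apply: (le_trans (dist _ _ _ _ (p_f n0) (p_f n))).
    have h1 : n0.+1%:R^-1 <= e' / 2 / (`|u| + 1) := n0P n0 (leqnn _).
    have h2 : n.+1%:R^-1 <= e' / 2 / (`|u| + 1) := n0P n nn0.
    apply: (@le_trans _ _ (e' / (`|u| + 1) * `|u|)).
      by rewrite ler_wpM2r// [e' in leRHS]splitr mulrDl lerD.
    by rewrite mulrAC ler_pdivrMr// ler_wpM2l ?(ltW e'0)// lerDl.
  exists (lim (poly_op (p_ n) T u @[n --> \oo])), p_; split=> //.
  apply/uniform_cvgP => e' /inv_small; apply: filterS => n ne t tN.
  exact: le_trans (p_f n t tN) ne.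
have [q [/uniform_cvgP qf qv]] := xgetPex 0 ex.
rewrite -/(spectral_calc T f u) in qv.
apply/ler_addgt0Pr => e' e'0.
have nu : 0 < `|u| + 1 by rewrite ltr_wpDl.
have e1 : 0 < e' / 2 / (`|u| + 1) by rewrite !divr_gt0.
have e2 : 0 < e' / 2 by rewrite divr_gt0.
move/cvgrPdist_le/(_ _ e2) in qv.
have [n [n1 n2]] := filter_ex (filterI (qf _ e1) qv).
have := dist _ _ _ _ n1 fp; rewrite mulrDl.
have : e' / 2 / (`|u| + 1) * `|u| <= e' / 2.
  by rewrite mulrAC ler_pdivrMr// ler_wpM2l ?(ltW e2)// lerDl.
have := ler_normD (spectral_calc T f u - poly_op (q n) T u)
  (poly_op (q n) T u - poly_op p T u); rewrite addrA subrK.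
lra.
Qed.

Lemma calc_ext f g u : nneg_continuous f -> nneg_continuous g ->
  (forall t, t \in `[0, opnorm T] -> f t = g t) ->
  spectral_calc T f u = spectral_calc T g u.
Proof.
move=> fc gc fg; apply: (@eq_of_norm_le _ _ _ _ (2 * `|u|)) => e e0.
have [p fp] := nneg_continuous_approx (opnorm T) fc e0.
have gp t : t \in `[0, opnorm T] -> `|g t - p.[t]| <= e.
  by move=> tN; rewrite -fg// fp.
apply: (le_trans (ler_distD (poly_op p T u) _ _)).
have := calc_close u fc fp; have := calc_close u gc gp.
by rewrite (distrC (poly_op p T u)); lra.
Qed.

Lemma calc_horner p u : spectral_calc T (horner p) u = poly_op p T u.
Proof.
have pp t : t \in `[0, opnorm T] -> `|p.[t] - p.[t]| <= 0 by rewrite subrr normr0.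
have := calc_close u (nneg_continuous_horner p) pp.
by rewrite mul0r normr_le0 subr_eq0 => /eqP.
Qed.

Lemma calc_cst c u : spectral_calc T (fun=> c) u = c *: u.
Proof.
rewrite -(poly_opC T) -calc_horner; apply: calc_ext => [||t _].
- exact: nneg_continuous_cst.
- exact: nneg_continuous_horner.
- by rewrite hornerC.
Qed.

Lemma calcP c f g u : nneg_continuous f -> nneg_continuous g ->
  spectral_calc T (fun t => c * f t + g t) u
  = c *: spectral_calc T f u + spectral_calc T g u.
Proof.
move=> fc gc; have fgc : nneg_continuous (fun t => c * f t + g t).
  by apply: nneg_continuousD gc; apply: nneg_continuousM fc; exact: nneg_continuous_cst.
apply: (@eq_of_norm_le _ _ _ _ (2 * (`|c| + 1) * `|u|)) => e e0.
have [p fp] := nneg_continuous_approx (opnorm T) fc e0.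
have [q gq] := nneg_continuous_approx (opnorm T) gc e0.
have fgpq t : t \in `[0, opnorm T] ->
    `|c * f t + g t - (c *: p + q).[t]| <= (`|c| + 1) * e.
  move=> tN; rewrite hornerD hornerZ opprD addrACA -mulrBr.
  apply: (le_trans (ler_normD _ _)); rewrite normrM mulrDl mul1r.
  by apply: lerD; rewrite ?gq// ler_wpM2l// fp.
apply: (le_trans (ler_distD (poly_op (c *: p + q) T u) _ _)).
have h := calc_close u fgc fgpq.
have hf := calc_close u fc fp; have hg := calc_close u gc gq.
have : `|poly_op (c *: p + q) T u - (c *: spectral_calc T f u + spectral_calc T g u)|
    <= (`|c| + 1) * e * `|u|.
  rewrite poly_opP opprD addrACA -scalerBr (le_trans (ler_normD _ _))//.
  rewrite normrZ mulrDl mulrDl mul1r -mulrA lerD//; last by rewrite distrC.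
  by rewrite ler_wpM2l// distrC.
lra.
Qed.

Lemma calc_is_linear f : nneg_continuous f -> linear (spectral_calc T f).
Proof.
move=> fc c u v; apply: (@eq_of_norm_le _ _ _ _ (`|c *: u + v| + `|c| * `|u| + `|v|)).
move=> e e0; have [p fp] := nneg_continuous_approx (opnorm T) fc e0.
have h w := calc_close w fc fp.
apply: (le_trans (ler_distD (poly_op p T (c *: u + v)) _ _)).
rewrite -addrA mulrDr lerD// linearP opprD addrACA -scalerBr.
apply: (le_trans (ler_normD _ _)); rewrite normrZ mulrDr lerD//; last by rewrite distrC.
by rewrite mulrCA ler_wpM2l// distrC.
Qed.

Lemma calc_norm_le c f u : nneg_continuous f -> 0 <= c ->
  (forall t, t \in `[0, opnorm T] -> `|f t| <= c) ->
  `|spectral_calc T f u| <= c * `|u|.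
Proof.
move=> fc c0 fle; apply/ler_addgt0Pr => e e0.
have nu : 0 < `|u| + 1 by rewrite ltr_wpDl.
have e1 : 0 < e / 2 / (`|u| + 1) by rewrite !divr_gt0.
have [p fp] := nneg_continuous_approx (opnorm T) fc e1.
have pc : forall t, t \in `[0, opnorm T] -> `|p.[t]| <= c + e / 2 / (`|u| + 1).
  move=> t tN; rewrite (_ : p.[t] = f t - (f t - p.[t])); last by ring.
  by apply: (le_trans (ler_normB _ _)); rewrite lerD ?fle ?fp.
have := poly_op_norm_le psdT u (addr_ge0 c0 (ltW e1)) pc; rewrite mulrDl.
have : e / 2 / (`|u| + 1) * `|u| <= e / 2.
  by rewrite mulrAC ler_pdivrMr// ler_wpM2l ?lerDl// divr_ge0// ltW.
have := calc_close u fc fp.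
have := ler_normD (spectral_calc T f u - poly_op p T u) (poly_op p T u).
rewrite subrK; lra.
Qed.

Lemma calc_dist_le f g e u : nneg_continuous f -> nneg_continuous g -> 0 <= e ->
  (forall t, t \in `[0, opnorm T] -> `|f t - g t| <= e) ->
  `|spectral_calc T f u - spectral_calc T g u| <= e * `|u|.
Proof.
move=> fc gc e0 fg; rewrite addrC -scaleN1r -calcP//; apply: calc_norm_le => //.
  by apply: nneg_continuousD fc; apply: nneg_continuousM gc; exact: nneg_continuous_cst.
by move=> t tN; rewrite mulN1r addrC fg.
Qed.

Lemma calcM f g u : nneg_continuous f -> nneg_continuous g ->
  spectral_calc T (fun t => f t * g t) u = spectral_calc T f (spectral_calc T g u).
Proof.
move=> fc gc.
have calcMh q : spectral_calc T (fun t => f t * q.[t]) u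
    = spectral_calc T f (poly_op q T u).
  have qc := nneg_continuous_horner q.
  have [c c0 qle] := nneg_continuous_bounded (opnorm T) qc.
  apply: (@eq_of_norm_le _ _ _ _ (c * `|u| + `|poly_op q T u|)) => e e0.
  have [p fp] := nneg_continuous_approx (opnorm T) fc e0.
  apply: (le_trans (ler_distD (poly_op (p * q) T u) _ _)); rewrite mulrDr lerD//.
    rewrite mulrA; apply: calc_close => [|t tN]; first exact: nneg_continuousM.
    by rewrite hornerM -mulrBl normrM ler_pM// ?fp ?qle.
  by rewrite poly_opM distrC; exact: calc_close.
have [c c0 fle] := nneg_continuous_bounded (opnorm T) fc.
apply: (@eq_of_norm_le _ _ _ _ (2 * c * `|u|)) => e e0.
have [q gq] := nneg_continuous_approx (opnorm T) gc e0.
apply: (le_trans (ler_distD (spectral_calc T f (poly_op q T u)) _ _)).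
have : `|spectral_calc T f (poly_op q T u) - spectral_calc T f (spectral_calc T g u)|
    <= c * (e * `|u|).
  have := calc_is_linear fc (-1) (spectral_calc T g u) (poly_op q T u).
  rewrite !scaleN1r ![- _ + _]addrC => <-.
  apply: (le_trans (calc_norm_le _ fc c0 fle)); rewrite ler_wpM2l//.
  by rewrite distrC; exact: calc_close.
have : `|spectral_calc T (fun t => f t * g t) u - spectral_calc T f (poly_op q T u)|
    <= c * e * `|u|.
  rewrite -calcMh; apply: calc_dist_le.
  - exact: nneg_continuousM.
  - by apply: nneg_continuousM => //; exact: nneg_continuous_horner.
  - by rewrite mulr_ge0// ltW.
  - by move=> t tN; rewrite -mulrBr normrM ler_pM// ?fle ?gq.
lra.
Qed.

Lemma calc_sym f u v : nneg_continuous f ->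
  dot (spectral_calc T f u) v = dot u (spectral_calc T f v).
Proof.
move=> fc; apply: (@eq_of_norm_le _ R^o _ _ (2 * (`|u| * `|v|))) => e e0.
have [p fp] := nneg_continuous_approx (opnorm T) fc e0.
have h w := calc_close w fc fp.
rewrite (_ : _ - _ = dot (spectral_calc T f u - poly_op p T u) v
  - dot u (spectral_calc T f v - poly_op p T v)); last first.
  by rewrite dotBl dotBr (poly_op_sym psdT); ring.
apply: (le_trans (ler_normB _ _)).
have := cauchy_schwarz (spectral_calc T f u - poly_op p T u) v.
have := cauchy_schwarz u (spectral_calc T f v - poly_op p T v).
have : `|u| * `|spectral_calc T f v - poly_op p T v| <= `|u| * (e * `|v|).
  by rewrite ler_wpM2l.
have : `|spectral_calc T f u - poly_op p T u| * `|v| <= e * `|u| * `|v|.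
  by rewrite ler_wpM2r.
lra.
Qed.

Lemma calc_ge0 f u : nneg_continuous f ->
  (forall t, t \in `[0, opnorm T] -> 0 <= f t) -> 0 <= dot (spectral_calc T f u) u.
Proof.
move=> fc f0; rewrite -oppr_le0; apply/ler_addgt0Pr => e e0; rewrite add0r.
have nu : 0 < `|u| ^+ 2 + 1 by rewrite ltr_wpDl ?sqr_ge0.
have e1 : 0 < e / 2 / (`|u| ^+ 2 + 1) by rewrite !divr_gt0.
set e' := _ / (_ + 1) in e1.
have [p fp] := nneg_continuous_approx (opnorm T) fc e1.
have : 0 <= dot (poly_op (p + e'%:P) T u) u.
  apply: poly_op_ge0 => // t tN; rewrite hornerD hornerC.
  by have := fp t tN; have := f0 t tN; rewrite ler_norml => ? /andP[_]; lra.
rewrite poly_opD poly_opC dotDl dotZl dotxx.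
have : e' * `|u| ^+ 2 <= e / 2.
  by rewrite /e' mulrAC ler_pdivrMr// ler_wpM2l ?lerDl// divr_ge0// ltW.
have : `|dot (spectral_calc T f u - poly_op p T u) u| <= e' * `|u| ^+ 2.
  apply: (le_trans (cauchy_schwarz _ _)).
  by rewrite expr2 mulrA ler_wpM2r//; exact: calc_close.
rewrite dotBl ler_norml => /andP[]; lra.
Qed.

(** Comparison of quadratic forms: the squares of the norms are the quadratic
    forms of the functions f^2, g^2 and h^2 of T, so that a pointwise inequality
    on the spectrum suffices. *)
Lemma calc_norm_le_hypot f g h u :
  nneg_continuous f -> nneg_continuous g -> nneg_continuous h ->
  (forall t, t \in `[0, opnorm T] -> f t ^+ 2 <= g t ^+ 2 + h t ^+ 2) ->
  `|spectral_calc T f u| ^+ 2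
  <= `|spectral_calc T g u| ^+ 2 + `|spectral_calc T h u| ^+ 2.
Proof.
move=> fc gc hc fgh.
have sqE k : nneg_continuous k ->
    `|spectral_calc T k u| ^+ 2 = dot (spectral_calc T (fun t => k t * k t) u) u.
  by move=> kc; rewrite calcM// calc_sym// dotxx.
have [ffc ggc hhc] := And3 (nneg_continuousM fc fc) (nneg_continuousM gc gc)
  (nneg_continuousM hc hc).
have sumc : nneg_continuous (fun t => 1 * (g t * g t) + h t * h t).
  by apply: nneg_continuousD hhc; apply: nneg_continuousM ggc; exact: nneg_continuous_cst.
have diffc : nneg_continuous
    (fun t => -1 * (f t * f t) + (1 * (g t * g t) + h t * h t)).
  by apply: nneg_continuousD sumc; apply: nneg_continuousM ffc; exact: nneg_continuous_cst.
have := calc_ge0 u diffc; rewrite !calcP// !dotDl !dotZl -!sqE// => ge0.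
suff : 0 <= -1 * `|spectral_calc T f u| ^+ 2
    + (1 * `|spectral_calc T g u| ^+ 2 + `|spectral_calc T h u| ^+ 2) by lra.
by apply: ge0 => t /fgh; rewrite !expr2; lra.
Qed.

Lemma calc_psd f (S : {linear X -> X}) : nneg_continuous f ->
  (forall t, 0 <= t -> 0 <= f t) -> (forall u, S u = spectral_calc T f u) -> psd_op S.
Proof.
move=> fc f0 SE; split=> [u v|u|].
- by rewrite !SE calc_sym.
- by rewrite SE calc_ge0// => t; rewrite in_itv/= => /andP[t0 _]; exact: f0.
- have [c c0 fle] := nneg_continuous_bounded (opnorm T) fc.
  by exists c => u; rewrite SE calc_norm_le.
Qed.

End Calculus.

(** For polynomials f the rule is the product rule. In general f is approximated
    on an interval that contains both [0, |S|] and the values of g on [0, |T|],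
    which avoids the spectral mapping theorem. *)
Lemma calc_comp (R : realType) (X : hilbertType R) (T S : {linear X -> X})
    (f g : R -> R) (u : X) : psd_op T ->
  nneg_continuous f -> nneg_continuous g -> (forall t, 0 <= t -> 0 <= g t) ->
  (forall v, S v = spectral_calc T g v) ->
  spectral_calc S f u = spectral_calc T (fun t => f (g t)) u.
Proof.
move=> psdT fc gc g0 SE; have psdS := calc_psd psdT gc g0 SE.
have hornerc p : nneg_continuous (fun t => p.[g t]).
  exact: (nneg_continuous_comp (nneg_continuous_horner p) gc).
have poly_comp p v : poly_op p S v = spectral_calc T (fun t => p.[g t]) v.
  elim/poly_ind: p v => [|p c IH] v.
    rewrite -polyC0 poly_opC -(calc_cst psdT); apply: calc_ext => [//|||t _].
    - exact: nneg_continuous_cst.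
    - exact: hornerc.
    - by rewrite hornerC.
  have pggc := nneg_continuousM (hornerc p) gc; have cc := nneg_continuous_cst c.
  rewrite poly_opD poly_opMX poly_opC IH SE -(calcM psdT)// -(calc_cst psdT).
  rewrite -[X in X + _]scale1r -(calcP psdT)//.
  apply: calc_ext => [//|||t _].
  - apply: nneg_continuousD cc.
    by apply: nneg_continuousM pggc; exact: nneg_continuous_cst.
  - exact: hornerc.
  - by rewrite hornerMXaddC mul1r.
have [c c0 gle] := nneg_continuous_bounded (opnorm T) gc.
apply: (@eq_of_norm_le _ _ _ _ (2 * `|u|)) => e e0.
have [p fp] := nneg_continuous_approx (Num.max (opnorm S) c) fc e0.
apply: (le_trans (ler_distD (poly_op p S u) _ _)).
have : `|spectral_calc S f u - poly_op p S u| <= e * `|u|.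
  apply: calc_close => // t; rewrite in_itv/= => /andP[t0 tS].
  by apply: fp; rewrite in_itv/= t0 le_max tS.
have : `|poly_op p S u - spectral_calc T (fun t => f (g t)) u| <= e * `|u|.
  rewrite poly_comp distrC; apply: calc_dist_le => // [||t tN].
  - exact: nneg_continuous_comp.
  - exact: ltW.
  - apply: fp; rewrite in_itv/=; have t0 : 0 <= t by move: tN; rewrite in_itv/= => /andP[].
    rewrite g0//= le_max; apply/orP; right.
    by rewrite (le_trans (ler_norm _))// gle.
lra.
Qed.

(** * The inverse of a self-adjoint operator bounded below *)

Lemma orthogonal_projection (R : realType) (X : hilbertType R) (V : set X) (x : X) :
  V 0 -> (forall c u v, V u -> V v -> V (c *: u + v)) ->
  (forall (y_ : nat -> X) z, (forall n, V (y_ n)) ->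
     y_ n @[n --> \oo] --> z -> V z) ->
  exists2 z, V z & forall y, V y -> dot (x - z) y = 0.
Proof.
move=> V0 Vlin Vclosed; set S := [set `|x - y| ^+ 2 | y in V].
have hinf : has_inf S.
  split; first by exists (`|x - 0| ^+ 2), 0.
  by exists 0 => _ [y _ <-]; exact: sqr_ge0.
set D := inf S; have Dle y : V y -> D <= `|x - y| ^+ 2.
  by move=> Vy; apply: inf_lbound; [case: hinf | exists y].
have /choice[y_ yP] : forall n : nat, exists y, V y /\ `|x - y| ^+ 2 < D + n.+1%:R^-1.
  move=> n; have n0 : 0 < n.+1%:R^-1 :> R by [].
  by have [_ [y Vy <-] yD] := inf_adherent n0 hinf; exists y.
have inv_small (e : R) : 0 < e -> exists n0 : nat, forall n, (n0 <= n)%N -> n.+1%:R^-1 <= e.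
  move=> e0; have [n0 _ n0P] := near_infty_natSinv_lt (PosNum e0).
  by exists n0 => n nn0; apply: ltW; exact: (n0P n nn0).
have parallelogram n k :
    `|y_ n - y_ k| ^+ 2 <= 2 * n.+1%:R^-1 + 2 * k.+1%:R^-1.
  have [[Vn nD] [Vk kD]] := (yP n, yP k).
  pose mid := 2^-1 *: y_ n + 2^-1 *: y_ k.
  have Vmid : V mid.
    by apply: (Vlin) => //; rewrite -[_ *: y_ k]addr0; exact: Vlin.
  have := Dle _ Vmid; move: nD kD; rewrite -!dotxx /mid.
  rewrite !(dotBl, dotBr, dotDl, dotDr, dotZl, dotZr).
  rewrite (dotC (y_ k) (y_ n)) (dotC (y_ n) x) (dotC (y_ k) x).
  move: (n.+1%:R^-1) (k.+1%:R^-1) => rn rk.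
  lra.
have ycvg : cvg (y_ n @[n --> \oo]).
  apply: cvg_of_cauchy => e e0; have e2 : 0 < e ^+ 2 / 4 by rewrite divr_gt0// exprn_gt0.
  have [n0 n0P] := inv_small _ e2; exists n0 => n nn0.
  rewrite -ler_sqr ?nnegrE ?(ltW e0)//; apply: (le_trans (parallelogram _ _)).
  by move: (n0P _ (leqnn _)) (n0P _ nn0); move: (n0.+1%:R^-1) (n.+1%:R^-1) => r0 r; lra.
set z := lim (y_ n @[n --> \oo]); have yz : y_ n @[n --> \oo] --> z by [].
exists z; first by apply: (Vclosed y_) => // n; have [] := yP n.
move=> y Vy; have [->|y0] := eqVneq y 0; first by rewrite dotC dot0l.
set b := dot (x - z) y.
have ny : 0 < `|y| ^+ 2 by rewrite exprn_gt0// normr_gt0.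
set t := b / `|y| ^+ 2.
suff : b ^+ 2 / `|y| ^+ 2 <= 0.
  by rewrite pmulr_lle0 ?invr_gt0// => b2; apply/eqP; rewrite -sqrf_eq0 eq_le b2 sqr_ge0.
apply/ler_addgt0Pr => e e0; rewrite add0r.
have t1 : 0 < 1 + 2 * `|t| by rewrite ltr_pwDl// mulr_ge0.
have e1 : 0 < e / (1 + 2 * `|t|) by rewrite divr_gt0.
set e' := e / _ in e1.
have [n0 n0P] := inv_small _ e1.
have [n [n0n bn]] : exists n, (n0 <= n)%N /\ `|dot z y - dot (y_ n) y| <= e'.
  have /cvgrPdist_le/(_ _ e1)[n1 _ n1P] := dot_cvgl y yz.
  exists (maxn n0 n1); split; first exact: leq_maxl.
  by apply: n1P; exact: leq_maxr.
have [Vn nD] := yP n.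
have := Dle (t *: y + y_ n) (Vlin _ _ _ Vy Vn).
have -> : `|x - (t *: y + y_ n)| ^+ 2
    = `|x - y_ n| ^+ 2 - 2 * t * dot (x - y_ n) y + t ^+ 2 * `|y| ^+ 2.
  rewrite -!dotxx !(dotBl, dotBr, dotDl, dotDr, dotZl, dotZr).
  by rewrite (dotC y x) (dotC y (y_ n)) (dotC (y_ n) x); ring.
have tb : t * b = b ^+ 2 / `|y| ^+ 2 by rewrite /t; ring.
have t2 : t ^+ 2 * `|y| ^+ 2 = t * b by rewrite /t; field; rewrite gt_eqF// normr_gt0.
rewrite t2 -tb (_ : dot (x - y_ n) y = b + (dot z y - dot (y_ n) y)); last first.
  by rewrite /b !dotBl; ring.
have : - (t * (dot z y - dot (y_ n) y)) <= `|t| * e'.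
  by rewrite (le_trans (ler_norm _))// normrN normrM ler_wpM2l.
move: nD (n0P _ n0n); move: (n.+1%:R^-1) => r; have : e' * (1 + 2 * `|t|) = e by rewrite /e' divfK// gt_eqF.
lra.
Qed.

Section Inverse.
Variables (R : realType) (X : hilbertType R) (B : partial_op X) (m : R).
Hypotheses (Bsa : self_adjoint B) (Bpos : positive_definite B) (m0 : 0 < m)
  (Bm : forall u, dom B u -> m * `|u| <= `|B u|).
Implicit Types u v : X.

Let domB c u v : dom B u -> dom B v -> dom B (c *: u + v).
Proof. by have [[_ Blin] _ _] := Bsa => du dv; have [] := Blin c u v du dv. Qed.

Let BP c u v : dom B u -> dom B v -> B (c *: u + v) = c *: B u + B v.
Proof. by have [[_ Blin] _ _] := Bsa => du dv; have [] := Blin c u v du dv. Qed.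

Let B0 : B 0 = 0.
Proof.
have [[d0 _] _ _] := Bsa; have := BP 1 d0 d0; rewrite !scale1r addr0 => e.
by apply: (addrI (B 0)); rewrite addr0 -e.
Qed.

Let B_sym u v : dom B u -> dom B v -> dot (B u) v = dot u (B v).
Proof. by have [_ _ adj] := Bsa => du dv; apply: (adj v (B v)).2 => //; split. Qed.

Lemma bounded_below_inj u v : dom B u -> dom B v -> B u = B v -> u = v.
Proof.
move=> du dv Buv; apply/eqP; rewrite -subr_eq0 -normr_le0 -(pmulr_rle0 _ m0).
rewrite addrC -scaleN1r; apply: (le_trans (Bm (domB _ dv du))).
by rewrite BP// scaleN1r Buv addNr normr0.
Qed.

(** The range is closed, because B is closed and bounded below. An element
    orthogonal to the range lies in the domain of the adjoint, that is of B, and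
    is mapped to 0; so it vanishes. *)
Lemma bounded_below_surj v : exists2 u, dom B u & B u = v.
Proof.
have [[d0 _] _ adj] := Bsa.
have [||y_ z yB yz|z [u du Buz] orth] := @orthogonal_projection _ _ (B @` dom B) v.
- by exists 0.
- by move=> c _ _ [u du <-] [u' du' <-]; exists (c *: u + u'); [exact: domB | exact: BP].
- have /choice[u_ uP] : forall n, exists u, dom B u /\ B u = y_ n.
    by move=> n; have [u] := yB n; exists u.
  have ucvg : cvg (u_ n @[n --> \oo]).
    apply: cvg_of_cauchy => e e0; have e1 : 0 < m * e / 2 by rewrite divr_gt0 ?mulr_gt0.
    have /cvgrPdist_le/(_ _ e1)[n0 _ n0P] := yz; exists n0 => n nn0.
    rewrite -(ler_pM2l m0) addrC -scaleN1r.
    have [[dn Bn] [dn0 Bn0]] := (uP n, uP n0).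
    apply: (le_trans (Bm (domB _ dn dn0))); rewrite BP// scaleN1r Bn Bn0 addrC.
    apply: (le_trans (ler_distD z _ _)); rewrite (distrC (y_ n0)).
    have h1 : `|z - y_ n0| <= m * e / 2 := n0P _ (leqnn _).
    have h2 : `|z - y_ n| <= m * e / 2 := n0P _ nn0.
    lra.
  set u := lim (u_ n @[n --> \oo]); have uu : u_ n @[n --> \oo] --> u by [].
  suff /adj[du Bu] : adjoint_graph B u z by exists u.
  move=> x dx; rewrite dotC (dotC x).
  have c1 := dot_cvgl (B x) uu; have := dot_cvgl x yz.
  have -> : (fun n => dot (y_ n) x) = (fun n => dot (u_ n) (B x)).
    by apply/funext => n; have [dn <-] := uP n; rewrite B_sym.
  by move=> c2; apply: (norm_cvg_unique c1 c2).
exists u => //; rewrite Buz; apply/esym/eqP; rewrite -subr_eq0; apply/eqP.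
have [dvz Bvz] : dom B (v - z) /\ B (v - z) = 0.
  apply/adj => x dx; have Vx : (B @` dom B) (B x) by exists x.
  by rewrite dotC (orth _ Vx) dotC dot0l.
by apply: bounded_below_inj => //; rewrite Bvz B0.
Qed.

Lemma inv_opP v : dom B (inv_op B v) /\ B (inv_op B v) = v.
Proof.
have [u du Bu] := bounded_below_surj v.
by apply: (@xgetPex _ 0 [set u | dom B u /\ B u = v]); exists u.
Qed.

Lemma inv_op_is_linear : linear (inv_op B).
Proof.
move=> c u v; have [[du Bu] [dv Bv]] := (inv_opP u, inv_opP v).
have [d e] := inv_opP (c *: u + v).
by apply: bounded_below_inj => //; [exact: domB | rewrite BP// Bu Bv].
Qed.

Lemma inv_op_psd (A : {linear X -> X}) : A =1 inv_op B -> psd_op A.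
Proof.
move=> AE; split=> [u v|u|].
- have [[du Bu] [dv Bv]] := (inv_opP u, inv_opP v).
  by rewrite !AE -{1}Bv -{2}Bu B_sym.
- have [du Bu] := inv_opP u; rewrite AE -{2}Bu dotC.
  have [->|u0] := eqVneq (inv_op B u) 0; first by rewrite dotC dot0l.
  exact/ltW/Bpos.
- exists m^-1 => u; have [du Bu] := inv_opP u.
  by rewrite AE mulrC ler_pdivlMr// mulrC -{2}Bu Bm.
Qed.

End Inverse.

(** * Scalar estimates *)

Lemma nneg_continuous_powR_ge0 (R : realType) (s : R) : 0 <= s ->
  nneg_continuous (fun t : R => t `^ s).
Proof.
rewrite le_eqVlt => /predU1P[<-|]; last exact: nneg_continuous_powR.
rewrite (_ : (fun t => _) = (fun=> 1)); first exact: nneg_continuous_cst.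
by apply/funext => t; rewrite powRr0.
Qed.

Lemma nneg_continuous_extend0 (R : realType) (phi : R -> R) : index_function phi ->
  nneg_continuous (extend0 phi).
Proof.
move=> [_ phic _ phi0]; apply/continuous_within_itvcyP; split; last first.
  rewrite {2}/extend0 ltxx; apply: cvg_trans phi0; apply: near_eq_cvg.
  by near=> t; rewrite /extend0; case: ifPn => // /negP[]; near: t; exact: nbhs_right_gt.
move=> t tpos; have t0 : 0 < t by move: tpos; rewrite in_itv/= andbT.
rewrite /continuous_at {2}/extend0 t0; apply: cvg_trans (phic t tpos).
apply: near_eq_cvg; near=> x; rewrite /extend0; case: ifPn => // /negP[].
near: x; exact: lt_nbhsr.
Unshelve. all: by end_near. Qed.

Lemma extend0_ge0 (R : realType) (phi : R -> R) t : index_function phi ->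
  0 <= extend0 phi t.
Proof.
by move=> [phi0 _ _ _]; rewrite /extend0; case: ifP => // /phi0/ltW.
Qed.

(** For x <= alpha the monotonicity of phi suffices. For alpha < x <= t0 the
    factor x / (x + alpha) is at most 1 and phi(x) / x^eta decreases. Beyond t0,
    where the quotient is not controlled, phi(x) / x^eta is at most
    phi(L') / phi(t0) times its value at t0. *)
Lemma filtered_index_bound (R : realType) (phi : R -> R) (eta L : R) :
  index_function phi -> quotient_incr_near0 phi eta -> 0 < eta -> eta <= 1 ->
  exists2 C, 0 < C & exists2 t0, 0 < t0 & forall alpha x,
    0 < alpha -> alpha <= t0 -> 0 <= x -> x <= L ->
    x `^ (1 - eta) * (extend0 phi x * (x + alpha)^-1)
    <= C * (alpha `^ (- eta) * phi alpha).
Proof.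
move=> [phi0 _ phile _] [t0 t00 incr] eta0 eta1.
have phi_le s t : 0 < s -> s <= t -> phi s <= phi t.
  by move=> s0 st; apply: phile => //; rewrite in_itv/= andbT// (lt_le_trans s0).
have decr s t : 0 < s -> s <= t -> t <= t0 -> t `^ (- eta) * phi t <= s `^ (- eta) * phi s.
  move=> s0; rewrite le_eqVlt => /predU1P[->//|st] tt0.
  have t'0 : 0 < t by exact: lt_trans st.
  have := ltW (incr _ _ s0 st tt0); rewrite !powRN.
  rewrite -lef_pV2 ?posrE ?divr_gt0 ?powR_gt0 ?phi0//.
  by rewrite !invf_div [phi t / _]mulrC [phi s / _]mulrC.
pose L' := Num.max L t0; have L'0 : 0 < L' by rewrite lt_max t00 orbT.
pose C := phi L' / phi t0.
have C1 : 1 <= C.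
  by rewrite ler_pdivlMr ?phi0// mul1r phi_le// le_max lexx orbT.
have C0 : 0 < C by exact: lt_le_trans C1.
exists C => //; exists t0 => // alpha x a0 at0 x0 xL.
have rhs0 : 0 < alpha `^ (- eta) * phi alpha by rewrite mulr_gt0 ?powR_gt0 ?phi0.
move: x0; rewrite le_eqVlt => /predU1P[<-|x0].
  by rewrite /extend0 ltxx mul0r mulr0 mulr_ge0// ltW.
rewrite /extend0 x0.
have powE y : 0 < y -> y `^ (1 - eta) = y * y `^ (- eta).
  move=> y0; rewrite powRD ?powRr1 ?(ltW y0)//.
  by apply/implyP => _; rewrite gt_eqF.
have xa0 : 0 < x + alpha by rewrite addr_gt0.
have [xa|ax] := leP x alpha.
  apply: (@le_trans _ _ (alpha `^ (- eta) * phi alpha)); last by rewrite ler_peMl// ltW.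
  rewrite mulrA ler_pdivrMr//.
  apply: (@le_trans _ _ (alpha `^ (1 - eta) * phi alpha)).
    apply: ler_pM; rewrite ?powR_ge0// ?phi_le// ?(ltW (phi0 _ _))//.
    by rewrite ge0_ler_powR ?nnegrE ?subr_ge0// ltW.
  by rewrite powE// -mulrA [leLHS]mulrC ler_wpM2l ?(ltW rhs0)// ler_wpDl// ltW.
have step : x `^ (1 - eta) * (phi x / (x + alpha)) <= x `^ (- eta) * phi x.
  rewrite mulrA ler_pdivrMr// powE// -mulrA [leLHS]mulrC ler_wpM2l ?mulr_ge0 ?powR_ge0 ?(ltW (phi0 _ _))//.
  by rewrite lerDl ltW.
apply: (le_trans step); have [xt|tx] := leP x t0.
  by apply: (le_trans (decr _ _ a0 (ltW ax) xt)); rewrite ler_peMl// ltW.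
apply: (@le_trans _ _ (t0 `^ (- eta) * phi L')).
  apply: ler_pM; rewrite ?powR_ge0// ?(ltW (phi0 _ _))//; last first.
    by apply: phi_le => //; rewrite le_max xL.
  by rewrite !powRN lef_pV2 ?posrE ?powR_gt0// ge0_ler_powR ?nnegrE// ltW.
rewrite (_ : phi L' = C * phi t0); last by rewrite /C divfK// gt_eqF// phi0.
by rewrite mulrCA ler_wpM2l ?(ltW C0)// decr.
Qed.

(** Young's inequality Y * 1 <= Y^p / p + 1^q / q for Y = (t / s)^2 and
    p = a + 1. The constants have sum 1 after squaring, which keeps the
    interpolation estimate free of additional factors. *)
Lemma young_interpolation (R : realType) (a s t : R) : 0 < a -> 0 < s -> 0 <= t ->
  t ^+ 2 <= (Num.sqrt (a + 1)^-1 / s `^ a * (t `^ a * t)) ^+ 2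
            + (Num.sqrt (a / (a + 1)) * s) ^+ 2.
Proof.
move=> a0 s0 t0; have a1 : 0 < a + 1 by rewrite addr_gt0.
rewrite !exprMn !sqr_sqrtr ?invr_ge0 ?divr_ge0 ?(ltW a0) ?(ltW a1)//.
have q0 : 0 < (a + 1) / a by rewrite divr_gt0.
have pq : (a + 1)^-1 + ((a + 1) / a)^-1 = 1.
  by rewrite invf_div; field; rewrite !gt_eqF.
have ts0 : 0 <= t / s by rewrite divr_ge0// ltW.
have := conjugate_powR (sqr_ge0 (t / s)) ler01 a1 q0 pq.
have sa0 : 0 < s `^ a by rewrite powR_gt0.
have -> : ((t / s) ^+ 2) `^ (a + 1) = ((s `^ a)^-1 * t `^ a * (t / s)) ^+ 2.
  rewrite -powR_mulrn// powRAC powR_mulrn ?powR_ge0//; congr (_ ^+ 2).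
  rewrite powRD; last by rewrite gt_eqF.
  rewrite powRr1// powRM ?invr_ge0 ?(ltW s0)// [_ * t `^ a]mulrC.
  have -> // : s^-1 `^ a = (s `^ a)^-1.
  by rewrite -[s^-1]powR_inv1 ?(ltW s0)// powRAC powR_inv1// powR_ge0.
rewrite mulr1 powR1 -(ler_pM2l (exprn_gt0 2 s0)) => h.
rewrite [leLHS](_ : _ = s ^+ 2 * (t / s) ^+ 2); last by field; rewrite gt_eqF.
apply: (le_trans h); rewrite le_eqVlt; apply/orP; left; apply/eqP.
by field; rewrite !gt_eqF.
Qed.

Lemma calcZ (R : realType) (X : hilbertType R) (T : {linear X -> X})
    (c : R) (f : R -> R) (u : X) : psd_op T -> nneg_continuous f ->
  spectral_calc T (fun t => c * f t) u = c *: spectral_calc T f u.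
Proof.
by move=> psdT fc; rewrite (calcM psdT _ (nneg_continuous_cst c))// calc_cst.
Qed.

(** * Interpolation and the auxiliary element *)

Lemma interpolation_inequality (R : realType) (X : hilbertType R)
    (A : {linear X -> X}) (a s M : R) (y : X) :
  psd_op A -> 0 < a -> 0 < s -> 0 <= M ->
  `|spectral_calc A (fun t => t `^ a) (A y)| <= s `^ a * M -> s * `|y| <= M ->
  `|A y| <= M.
Proof.
move=> psdA a0 s0 M0 weak strong.
have a1 : 0 < a + 1 by rewrite addr_gt0.
have sa0 : 0 < s `^ a by rewrite powR_gt0.
have powc := nneg_continuous_powR a0; have idc := nneg_continuous_horner ('X : {poly R}).
have AE : spectral_calc A (horner 'X) y = A y by rewrite calc_horner// poly_opX.
set k1 := Num.sqrt (a + 1)^-1; set k2 := Num.sqrt (a / (a + 1)).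
have := @calc_norm_le_hypot _ _ _ psdA (horner 'X)
  (fun t => k1 / s `^ a * (t `^ a * 'X.[t])) (fun=> k2 * s) y idc.
rewrite calcZ//; last exact: nneg_continuousM.
rewrite calcM// calc_cst// AE !normrZ !exprMn.
have gc : nneg_continuous (fun t => k1 / s `^ a * (t `^ a * 'X.[t])).
  by apply: nneg_continuousM (nneg_continuous_cst _) _; exact: nneg_continuousM.
move=> /(_ gc (nneg_continuous_cst _)) hyp.
rewrite -ler_sqr ?nnegrE//; apply: (le_trans (hyp _)).
  move=> t; rewrite in_itv/= hornerX => /andP[t0 _].
  by rewrite -[k2 ^+ 2 * _]exprMn; exact: young_interpolation.
rewrite !real_normK ?num_real// /k1 /k2 !sqr_sqrtr ?invr_ge0 ?divr_ge0 ?(ltW a0) ?(ltW a1)//.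
set W := `|_| in weak *; have W0 : 0 <= W by exact: normr_ge0.
have W2 : (s `^ a)^-1 ^+ 2 * W ^+ 2 <= M ^+ 2.
  rewrite -exprMn ler_sqr ?nnegrE ?mulr_ge0 ?invr_ge0 ?(ltW sa0)//.
  by rewrite mulrC ler_pdivrMr// mulrC.
have Y2 : s ^+ 2 * `|y| ^+ 2 <= M ^+ 2.
  by rewrite -exprMn ler_sqr ?nnegrE ?mulr_ge0 ?(ltW s0).
have convex : (a + 1)^-1 * M ^+ 2 + a / (a + 1) * M ^+ 2 = M ^+ 2.
  by rewrite -mulrDl; field; rewrite gt_eqF.
rewrite -[leRHS]convex; apply: lerD; rewrite -[leLHS]mulrA ler_wpM2l ?invr_ge0 ?divr_ge0 ?(ltW a0) ?(ltW a1)//.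
Qed.

(** With r = 2 a + 2 and R = (A^r + s^r)^-1 phi(A^r), the choice is v0 = s^r R w
    and v1 = A^(r-1) R w. If u_dag - ubar = phi(A^r) w, then ubar + A v1 is the
    auxiliary element and v0 = u_dag - (ubar + A v1) its error. *)
Lemma source_splitting (R : realType) (X : hilbertType R) (A : {linear X -> X})
    (phi : R -> R) (a : R) (w : X) :
  psd_op A -> 0 < a -> index_function phi ->
  (forall eta : R, 0 < eta -> quotient_incr_near0 phi eta) ->
  exists2 C, 0 < C & exists2 t0, 0 < t0 & forall s, 0 < s -> s `^ (2 * a + 2) <= t0 ->
  exists v0 v1 : X,
    [/\ v0 + A v1 = spectral_calc A (fun t => extend0 phi (t `^ (2 * a + 2))) w,
        `|v0| <= C * phi (s `^ (2 * a + 2)),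
        `|spectral_calc A (fun t => t `^ a) v0| <= s `^ a * (C * phi (s `^ (2 * a + 2)))
      & s * `|v1| <= C * phi (s `^ (2 * a + 2))].
Proof.
move=> psdA a0 phiI quot; set r := 2 * a + 2.
have r0 : 0 < r by rewrite /r addr_gt0// mulr_gt0.
have phic := nneg_continuous_extend0 phiI.
have powc := nneg_continuous_powR r0.
have phirc : nneg_continuous (fun t => extend0 phi (t `^ r)).
  by apply: nneg_continuous_comp phic powc _ => t _; exact: powR_ge0.
have [Nnn _] := opnormP psdA; set L := opnorm A `^ r.
pose kap alpha e t := t `^ e * (extend0 phi (t `^ r) * (t `^ r + alpha)^-1).
have kapc alpha e : 0 < alpha -> 0 <= e -> nneg_continuous (kap alpha e).
  move=> al0 e0; apply: nneg_continuousM (nneg_continuous_powR_ge0 e0) _.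
  apply: nneg_continuousM phirc _; apply: nneg_continuousV.
    exact: nneg_continuousD powc (nneg_continuous_cst _).
  by move=> t _; rewrite ltr_wpDl// powR_ge0.
have kap_bound e : 0 <= e -> e < r -> exists2 C, 0 < C & exists2 t0, 0 < t0 &
    forall s, 0 < s -> s `^ r <= t0 ->
    `|spectral_calc A (kap (s `^ r) e) w| <= C * (s `^ e / s `^ r * phi (s `^ r)).
  (* t^e is x^(1 - eta) for x = t^r. *)
  move=> e0 er; pose eta := 1 - e / r.
  have eta0 : 0 < eta by rewrite subr_gt0 ltr_pdivrMr// mul1r.
  have eta1 : eta <= 1 by rewrite gerBl divr_ge0// ltW.
  have [C C0 [t0 t00 bnd]] := filtered_index_bound L phiI (quot _ eta0) eta0 eta1.
  exists (C * (`|w| + 1)); first by rewrite mulr_gt0// ltr_wpDl.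
  exists t0 => // s s0 st; have al0 : 0 < s `^ r by rewrite powR_gt0.
  have phi0 : 0 < phi (s `^ r) by case: phiI => h _ _ _; exact: h.
  have powre t : 0 <= t -> (t `^ r) `^ (1 - eta) = t `^ e.
    by move=> t_ge0; rewrite -powRrM /eta subKr mulrC divfK// gt_eqF.
  set P := s `^ e / s `^ r * phi (s `^ r).
  have P0 : 0 < P by rewrite !mulr_gt0 ?invr_gt0 ?powR_gt0.
  apply: (@le_trans _ _ (C * P * `|w|)); last first.
    by rewrite mulrAC ler_wpM2r ?(ltW P0)// ler_wpM2l ?(ltW C0)// lerDl.
  apply: (calc_norm_le psdA); first exact: kapc.
    by rewrite mulr_ge0 ?ltW.
  move=> t; rewrite in_itv/= => /andP[t_ge0 tN].
  have tr0 : 0 <= t `^ r := powR_ge0 _ _.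
  rewrite ger0_norm; last first.
    by rewrite /kap !mulr_ge0 ?powR_ge0 ?extend0_ge0// invr_ge0 addr_ge0 ?powR_ge0.
  have := bnd _ _ al0 st tr0; rewrite powre// => h; apply: (le_trans (h _)).
    by rewrite ge0_ler_powR ?nnegrE// ltW.
  rewrite le_eqVlt; apply/orP; left; apply/eqP; congr (_ * (_ * _)).
  have -> : - eta = (1 - eta) - 1 by ring.
  rewrite powRB; last by apply/implyP => _; rewrite gt_eqF.
  by rewrite powre ?(ltW s0)// powRr1// ltW.
have ar : a < r by rewrite /r; lra.
have r10 : 0 <= r - 1 by rewrite /r; lra.
have r1r : r - 1 < r by lra.
have [C0 C00 [t0 t00 h0]] := kap_bound 0 (lexx _) r0.
have [Ca Ca0 [ta ta0 ha]] := kap_bound a (ltW a0) ar.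
have [C1 C10 [t1 t10 h1]] := kap_bound (r - 1) r10 r1r.
exists (C0 + Ca + C1); first by rewrite !addr_gt0.
exists (Num.min t0 (Num.min ta t1)); first by rewrite !lt_min t00 ta0.
move=> s s0; rewrite !le_min => /and3P[st0 sta st1].
have al0 : 0 < s `^ r by rewrite powR_gt0.
set alpha := s `^ r in al0 st0 sta st1 *.
have phi0 : 0 < phi alpha by case: phiI => h _ _ _; exact: h.
have alV : alpha * alpha^-1 = 1 by rewrite divff// gt_eqF.
exists (alpha *: spectral_calc A (kap alpha 0) w), (spectral_calc A (kap alpha (r - 1)) w).
have [k0c kac] := (kapc _ _ al0 (lexx 0), kapc _ _ al0 (ltW a0)).
have k1c := kapc _ _ al0 r10.
have idc := nneg_continuous_horner ('X : {poly R}).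
have tt t : 0 <= t -> t * t `^ (r - 1) = t `^ r.
  move=> t_ge0; rewrite -{1}[t]powRr1// -powRD; first by rewrite addrC subrK.
  by apply/implyP; rewrite addrC subrK gt_eqF.
split.
- rewrite -[A _](poly_opX A) -(calc_horner psdA) -(calcM psdA)// -(calcP psdA)//; last first.
    exact: nneg_continuousM.
  apply: (calc_ext psdA) => //.
    by apply: nneg_continuousD; apply: nneg_continuousM => //; exact: nneg_continuous_cst.
  move=> t; rewrite in_itv/= hornerX => /andP[t_ge0 _]; rewrite /kap powRr0 mul1r.
  have den : t `^ r + alpha != 0 by rewrite gt_eqF// ltr_wpDl// powR_ge0.
  by rewrite (mulrA t) tt// -mulrDl addrC; field.
- rewrite normrZ (ger0_norm (ltW al0)) -ler_pdivlMl//.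
  apply: (le_trans (h0 _ s0 st0)); rewrite powRr0 -/alpha mulrCA mul1r ler_wpM2l ?invr_ge0 ?(ltW al0)//.
  by rewrite ler_wpM2r ?(ltW phi0)//; lra.
- have powa := nneg_continuous_powR a0.
  have ak0c : nneg_continuous (fun t => alpha * kap alpha 0 t).
    by apply: nneg_continuousM k0c; exact: nneg_continuous_cst.
  have akac : nneg_continuous (fun t => alpha * kap alpha a t).
    by apply: nneg_continuousM kac; exact: nneg_continuous_cst.
  have -> : spectral_calc A (fun t => t `^ a) (alpha *: spectral_calc A (kap alpha 0) w)
      = alpha *: spectral_calc A (kap alpha a) w.
    rewrite -!calcZ// -calcM//; apply: calc_ext => //; first exact: nneg_continuousM.
    by move=> t _; rewrite /kap powRr0; ring.
  rewrite normrZ (ger0_norm (ltW al0)).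
  apply: (le_trans (ler_wpM2l (ltW al0) (ha _ s0 sta))); rewrite -/alpha.
  rewrite (_ : alpha * _ = s `^ a * (Ca * phi alpha)); last by field; rewrite gt_eqF.
  by rewrite ler_wpM2l ?powR_ge0// ler_wpM2r ?(ltW phi0)//; lra.
- apply: (le_trans (ler_wpM2l (ltW s0) (h1 _ s0 st1))); rewrite -/alpha.
  rewrite (_ : s * _ = C1 * (s * s `^ (r - 1) * alpha^-1 * phi alpha)); last by ring.
  by rewrite tt ?(ltW s0)// -/alpha alV mul1r ler_wpM2r ?(ltW phi0)//; lra.
Qed.

(** * The Tikhonov minimizers *)

Lemma power_opN (R : realType) (X : hilbertType R) (B : partial_op X) (s : R) (u : X) :
  0 < s -> power_op B (- s) u = neg_power B s u.
Proof. by move=> s0; rewrite /power_op oppr_gt0 oppr_lt0 ltNge (ltW s0) s0 opprK. Qed.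

Section ScaleOne.
Variables (R : realType) (X : hilbertType R) (B : partial_op X).
Variable A : {linear X -> X}.
Hypotheses (psdA : psd_op A) (AE : (A : X -> X) = inv_op B) (A_inj : injective A).

Let neg_power1 y : neg_power B 1 y = A y.
Proof.
rewrite /neg_power -AE -(poly_opX A) -calc_horner//; apply: calc_ext => //.
- exact: nneg_continuous_powR.
- exact: nneg_continuous_horner.
- by move=> t; rewrite in_itv/= hornerX => /andP[t0 _]; exact: powRr1.
Qed.

Lemma scale_space1P u : scale_space B 1 u <-> exists y, A y = u.
Proof.
rewrite /scale_space /power_op ltr01 /=; split=> [[y _ yu]|[y yu]].
  by exists y; rewrite -neg_power1.
by exists y => //; rewrite neg_power1.
Qed.

Lemma scale_norm1 y : scale_norm B 1 (A y) = `|y|.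
Proof.
rewrite /scale_norm /power_op ltr01 /=; congr (`|_|).
have [|_ ] := @xgetPex _ 0 [set u : X | setT u /\ neg_power B 1 u = A y].
  by exists y; rewrite /= neg_power1.
by rewrite neg_power1 => /A_inj.
Qed.

End ScaleOne.

Theorem theorem5p3
  (R : realType) (X Y : hilbertType R)
  (hX : infinite_dimensional X) (hY : infinite_dimensional Y)
  (B : partial_op X) (m : R)
  (hBsa : self_adjoint B) (hBpos : positive_definite B)
  (hBunb : unbounded_op B)
  (hm : 0 < m) (hBm : forall u, dom B u -> m * `|u| <= `|B u|)
  (DF : set X) (F : X -> Y)
  (hFweak : weakly_seq_continuous DF F)
  (hDFclosed : closed DF) (hDFconvex : convex_set (DF : set (convex_lmodType X)))
  (hD0 : DF `&` scale_space B 1 !=set0)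
  (udag : X) (fdag : Y)
  (hudagD : DF udag) (hFudag : F udag = fdag) (hudagint : interior DF udag)
  (ubar : X) (hubar : (DF `&` scale_space B 1) ubar)
  (a ca Ca : R) (ha : 0 < a) (hca : 0 < ca) (hcaCa : ca <= Ca)
  (hF : forall u, (DF `&` scale_space B 1) u ->
     ca * scale_norm B (- a) (u - udag) <= `|F u - fdag| /\
     `|F u - fdag| <= Ca * scale_norm B (- a) (u - udag))
  (phi : R -> R)
  (hphi : index_function phi)
  (hquot : forall eta : R, 0 < eta -> quotient_incr_near0 phi eta)
  (w : X)
  (hsource : udag - ubar =
     spectral_calc (power_op B (- (2 * a + 2))) (extend0 phi) w) :
  exists2 K0 : R, 0 < K0 &
  exists2 alphabar : R, 0 < alphabar &
  forall delta : R, 0 < delta ->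
  forall alpha : R, 0 < alpha -> alpha <= alphabar ->
  forall fdelta : Y, `|fdelta - fdag| <= delta ->
  forall u : X, regularized_solution B DF F ubar fdelta alpha u ->
    `|u - udag| <= K0 * phi alpha
       + Num.max (2 / ca) 1 * (delta / alpha `^ (a / (2 * a + 2))).
Proof.
have lin := inv_op_is_linear hBsa hm hBm.
pose A : {linear X -> X} :=
  HB.pack (opval (inv_op B)) (GRing.isLinear.Build _ _ _ _ _ lin).
have AE : (A : X -> X) = inv_op B by [].
have psdA : psd_op A by apply: (inv_op_psd hBsa hBpos hm hBm).
have A_inj : injective A.
  move=> y y' Ayy'; have [_ e] := inv_opP hBsa hm hBm y.
  by have [_ e'] := inv_opP hBsa hm hBm y'; rewrite -e -e' -AE Ayy'.
have r0 : 0 < 2 * a + 2 by lra.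
set r := 2 * a + 2 in r0 hsource *.
have powr := nneg_continuous_powR r0; have powa := nneg_continuous_powR ha.
pose Sa : {linear X -> X} := HB.pack (spectral_calc A (fun t => t `^ a))
  (GRing.isLinear.Build _ _ _ _ _ (calc_is_linear psdA powa)).
have normaE v : scale_norm B (- a) v = `|Sa v|.
  by rewrite /scale_norm power_opN.
have source : udag - ubar = spectral_calc A (fun t => extend0 phi (t `^ r)) w.
  pose G : {linear X -> X} := HB.pack (spectral_calc A (fun t => t `^ r))
    (GRing.isLinear.Build _ _ _ _ _ (calc_is_linear psdA powr)).
  have GE : (power_op B (- r) : X -> X) = G by apply/funext => v; rewrite power_opN.
  rewrite hsource GE; apply: calc_comp => //; first exact: nneg_continuous_extend0.
  by move=> t _; exact: powR_ge0.
have [C C0 [t0 t00 splitting]] := source_splitting w psdA ha hphi hquot.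
have [rho rho0 ball_rho] : exists2 rho : R, 0 < rho & forall v, `|udag - v| < rho -> DF v.
  have /nbhs_ballP[rho rho0 h] := hudagint; exists rho => // v vr.
  by apply: h; rewrite -ball_normE.
have [t1 t10 small_phi] : exists2 t1 : R, 0 < t1 &
    forall t, 0 < t -> t < t1 -> C * phi t < rho.
  have [phi0 _ _ phicvg] := hphi.
  have rC : 0 < rho / C by rewrite divr_gt0.
  have /cvgrPdist_lt/(_ _ rC) := phicvg; rewrite near_withinE => /nbhs_ballP[t1 /= t10 h].
  exists t1 => // t t_gt0 tt1; have := h t; rewrite /ball/= !sub0r !normrN.
  rewrite !gtr0_norm ?phi0// => /(_ tt1 t_gt0); rewrite ltr_pdivlMr//; lra.
pose K := (Ca + 1) * C / ca + (Ca + 1) * C + C.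
have Ca0 : 0 < Ca by exact: lt_le_trans hcaCa.
have K0 : 0 < K by rewrite /K !addr_gt0// ?divr_gt0 ?mulr_gt0 ?addr_gt0.
exists (K + C); first by rewrite addr_gt0.
(* t1 / 2 because t1 itself only bounds admissible alpha strictly. *)
exists (Num.min t0 (t1 / 2)); first by rewrite lt_min t00 divr_gt0.
move=> delta delta0 alpha al0; rewrite le_min => /andP[alt0 alt1] fdelta fd u [DFu umin].
pose s := alpha `^ r^-1; have s0 : 0 < s by rewrite powR_gt0.
have sr : s `^ r = alpha by rewrite -powRrM mulVf ?gt_eqF// powRr1// ltW.
have := splitting s s0; rewrite -/r sr -source => /(_ alt0)[v0 [v1 []]].
set Cphi := C * phi alpha => udec nv0 nSv0 nv1.
set sa := s `^ a in nSv0; have sa0 : 0 < sa by rewrite powR_gt0.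
have -> : alpha `^ (a / r) = sa by rewrite /sa /s -powRrM mulrC.
have sas : sa * s = s `^ (a + 1).
  by rewrite powRD ?powRr1 ?(ltW s0)//; apply/implyP => _; rewrite gt_eqF.
have alE : alpha = (sa * s) ^+ 2.
  rewrite sas -(powR_mulrn 2 (powR_ge0 _ _)) -powRrM -[LHS]sr; congr (_ `^ _).
  by rewrite /r; ring.
have phial0 : 0 < phi alpha by case: hphi => h _ _ _; exact: h.
have Cphi0 : 0 < Cphi by rewrite mulr_gt0.
have [DFubar /(scale_space1P psdA AE)[y0 y0E]] := hubar.
(* The auxiliary element, which the minimizer u is compared with. *)
set ual := ubar + A v1.
have ualE : ual = A (y0 + v1) by rewrite linearD y0E.
have udual : ual - udag = - v0.
  have -> : v0 = udag - ubar - A v1 by rewrite -udec addrK.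
  by rewrite /ual !opprB addrCA addrA.
have DFual : DF ual.
  apply: ball_rho; rewrite -normrN opprB udual normrN; apply: (le_lt_trans nv0).
  by apply: small_phi => //; lra.
have ssual : scale_space B 1 ual by apply/(scale_space1P psdA AE); exists (y0 + v1).
have Fual : `|F ual - fdelta| <= Ca * (sa * Cphi) + delta.
  apply: (le_trans (ler_distD fdag _ _)); apply: lerD; last by rewrite distrC.
  have [_ h] := hF ual (conj DFual ssual); apply: (le_trans h).
  by rewrite normaE udual linearN normrN ler_wpM2l ?(ltW Ca0).
have := umin ual DFual; rewrite /tikhonov (mem_set ssual).
case: ifPn => [/set_mem /[dup] ssu /(scale_space1P psdA AE)[y yE]|_]; last first.
  by rewrite leye_eq.
have -> : ual - ubar = A v1 by rewrite /ual addrC addKr.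
have uubar : u - ubar = A (y - y0) by rewrite linearB yE y0E.
rewrite uubar !(scale_norm1 psdA AE A_inj) lee_fin alE => min_le.
pose E := sa * ((Ca + 1) * Cphi) + delta.
have E0 : 0 < E by rewrite addr_gt0// !mulr_gt0// addr_gt0.
have rhsE : `|F ual - fdelta| ^+ 2 + (sa * s) ^+ 2 * `|v1| ^+ 2 <= E ^+ 2.
  rewrite -exprMn; set P := `|_| in Fual *; set V := _ * `|v1|.
  have P0 : 0 <= P := normr_ge0 _.
  have V0 : 0 <= V by rewrite !mulr_ge0// ltW.
  have : V <= sa * Cphi by rewrite /V -mulrA ler_wpM2l// ltW.
  move=> Vle; have : P + V <= E by rewrite /E; lra.
  by clear -P0 V0 E0; nra.
have Fu : `|F u - fdelta| <= E.
  rewrite -ler_sqr ?nnegrE// ?(ltW E0)//; apply: le_trans rhsE; apply: le_trans min_le.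
  by rewrite lerDl mulr_ge0 ?sqr_ge0.
have yy0 : sa * s * `|y - y0| <= E.
  rewrite -ler_sqr ?nnegrE ?mulr_ge0 ?(ltW E0) ?(ltW sa0) ?(ltW s0)// exprMn.
  by apply: le_trans rhsE; apply: le_trans min_le; rewrite lerDr sqr_ge0.
(* Data errors are measured in units of s^a, the scale of the weak norm. *)
pose D := delta / sa; have deltaE : delta = sa * D by rewrite /D mulrC divfK// gt_eqF.
have D0 : 0 < D by rewrite divr_gt0.
have k2l : 2 / ca <= Num.max (2 / ca) 1 by rewrite le_max lexx.
have k2r : 1 <= Num.max (2 / ca) 1 by rewrite le_max lexx orbT.
pose M := K * phi alpha + Num.max (2 / ca) 1 * D.
rewrite -alE -/D.
have uz : u - ual = A (y - (y0 + v1)) by rewrite linearB yE ualE.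
suff uM : `|A (y - (y0 + v1))| <= M.
  apply: (le_trans (ler_distD ual _ _)); rewrite uz udual normrN.
  by move: uM nv0; rewrite /M /Cphi; lra.
have M0 : 0 <= M by rewrite addr_ge0// mulr_ge0 ?(ltW D0) ?(ltW K0) ?(ltW phial0)// (le_trans ler01).
have Kphi : K * phi alpha = (Ca + 1) * Cphi / ca + (Ca + 1) * Cphi + Cphi.
  by rewrite /K /Cphi; ring.
have q0 : 0 < (Ca + 1) * Cphi by rewrite mulr_gt0// addr_gt0.
have EE : E = sa * ((Ca + 1) * Cphi + D) by rewrite /E {1}deltaE; ring.
have kD1 : D <= Num.max (2 / ca) 1 * D by rewrite ler_peMl// ltW.
have kD2 : 2 / ca * D <= Num.max (2 / ca) 1 * D by rewrite ler_wpM2r// ltW.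
apply: (interpolation_inequality psdA ha s0 M0).
- have [hu _] := hF u (conj DFu ssu).
  have -> : A (y - (y0 + v1)) = (u - udag) + v0.
    by rewrite -uz -[v0]opprK -udual opprB addrA subrK.
  change (`|Sa (u - udag + v0)| <= sa * M); rewrite linearD.
  apply: (le_trans (ler_normD _ _)).
  have : `|Sa (u - udag)| <= (E + delta) / ca.
    rewrite ler_pdivlMr// mulrC -normaE; apply: (le_trans hu).
    by apply: (le_trans (ler_distD fdelta _ _)); rewrite lerD.
  have -> : (E + delta) / ca = sa * ((Ca + 1) * Cphi / ca + 2 / ca * D).
    by rewrite EE deltaE; ring.
  move=> h; apply: (le_trans (lerD h nSv0)); rewrite -mulrDr ler_pM2l// /M Kphi.
  by lra.
- apply: (@le_trans _ _ (s * `|y - y0| + s * `|v1|)).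
    rewrite -mulrDr ler_pM2l// opprD addrA; apply: (le_trans (ler_normD _ _)).
    by rewrite normrN.
  have : s * `|y - y0| <= (Ca + 1) * Cphi + D.
    by rewrite -(ler_pM2l sa0) mulrA -EE.
  have : 0 < (Ca + 1) * Cphi / ca by rewrite divr_gt0.
  by rewrite /M Kphi; lra.
Qed.
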